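(* Let $K$ be a field, let $A_3=K[x_1,x_2,x_3]$, and let $I\subseteq A_3$ be any homogeneous radical ideal. Then there is $D\in\mathbb{N}$ such that $I^{(n)}$ is generated in degrees $\leq Dn$ for all $n>0$.
   Context: The polynomial ring $A=A_3$ carries the standard grading. For an ideal $I$ of $A$, the $n$-th symbolic power is $I^{(n)}:=\bigcap_{\mathfrak p\in \mathrm{Ass}(I)}(I^nA_{\mathfrak p}\cap A)$, where $\mathrm{Ass}(I)$ denotes the set of associated primes of $A/I$. An ideal is generated in degrees $\leq d$ if it has a generating set consisting of polynomials of degree $\leq d$; for a homogeneous ideal these may be taken homogeneous. *)

(* Defs.v *)
From mathcomp Require Import all_boot all_algebra.
From mathcomp Require Import classical_sets.
From mathcomp Require Import mpoly.

Set Implicit Arguments.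
Unset Strict Implicit.
Unset Printing Implicit Defensive.

Import GRing.Theory.

Local Open Scope classical_set_scope.
Local Open Scope ring_scope.

(* Ideals are arbitrary (not necessarily decidable) sets. Unlike mathcomp's
   idealr_closed, is_ideal does not require properness. *)
Section Ideals.
Variable R : comNzRingType.
Implicit Types (I J P S : set R) (n : nat).

Definition is_ideal I :=
  [/\ I 0, (forall f g, I f -> I g -> I (f + g))
         & (forall a f, I f -> I (a * f))].

Definition is_prime P :=
  [/\ is_ideal P, ~ P 1 & (forall a b, P (a * b) -> P a \/ P b)].

Definition is_radical I := forall f n, I (f ^+ n) -> I f.

Definition ideal_gen S : set R :=
  [set f | exists (m : nat) (a g : 'I_m -> R),
     (forall i, S (g i)) /\ f = \sum_(i < m) a i * g i].

Definition ideal_exp I n : set R :=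
  ideal_gen [set f | exists g : 'I_n -> R,
     (forall i, I (g i)) /\ f = \prod_(i < n) g i].

(* Associated primes of the module R / I: the prime ideals which are the
   annihilator of the class of some f. *)
Definition Ass I : set (set R) :=
  [set P | is_prime P /\ exists f, P = [set a | I (a * f)]].

End Ideals.

Section SymbolicPower.
Variable R : idomainType.
Implicit Types (I J P : set R) (n : nat).

(* R_P, as a subring of the fraction field of the domain R *)
Definition localization P : set {fraction R} :=
  [set x | exists a s : R, ~ P s /\ x = tofrac a / tofrac s].

(* The extension J R_P of the ideal J *)
Definition ideal_ext P J : set {fraction R} :=
  [set x | exists (m : nat) (c : 'I_m -> {fraction R}) (g : 'I_m -> R),
     [/\ (forall i, localization P (c i)), (forall i, J (g i))
       & x = \sum_(i < m) c i * tofrac (g i)]].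

(* For I = R there is no associated prime, and the intersection is R. *)
Definition symbolic_power I n : set R :=
  \bigcap_(P in Ass I) (@tofrac R @^-1` ideal_ext P (ideal_exp I n)).

End SymbolicPower.

Section Grading.
Variables (k : nat) (K : fieldType).
Implicit Types I : set {mpoly K[k]}.

(* I is stable under taking homogeneous components, for total degree. *)
Definition is_homogeneous I :=
  forall f d, I f -> I (pihomog mdeg d f).

(* msize f is deg f + 1, and 0 for f = 0. *)
Definition generated_in_degrees_le (d : nat) I :=
  exists S : set {mpoly K[k]},
    (forall f, S f -> (msize f <= d.+1)%N) /\ I = ideal_gen S.

End Grading.

(* Main.v *)
(* Dividing out the common prime factors p of I replaces I = pJ by J, with
   I^(n) = p^n J^(n), so one may assume that J has no common factor: V(J) is then
   a finite set of points of the projective plane, and some form l of positive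
   degree avoids all of them.  Thus every monomial of some degree s lies in
   J + (l), and every monomial of degree sn in J^n + (l).  Since l is a
   nonzerodivisor modulo J^(n), a form h of J^(n) of degree > sn can be written
   u + l c, with u in the ideal generated by forms of J^(n) of degree <= sn and
   c in J^(n) of smaller degree than h. *)

Require Import Defs.
From HB Require Import structures.
From mathcomp Require Import all_boot all_algebra fingroup perm.
From mathcomp Require Import boolp classical_sets.
From mathcomp Require Import mpoly.
From mathcomp Require Import zify ring.

Set Implicit Arguments.
Unset Strict Implicit.
Unset Printing Implicit Defensive.

Import GRing.Theory.

Local Open Scope classical_set_scope.
Local Open Scope ring_scope.

(** No point and no dimension appears below. [K] may be finite, so a linear form avoiding the zeros
    of J need not exist, and the zeros need not be rational; avoidance is therefore expressed by
    asking that every variable lie in the radical of J + (l). Finiteness of the zero set is replaced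
    by [no_common_prime]: Gauss's lemma and Bezout relations over a fraction field then give, for
    each variable, a nonzero form of J free of it. With three variables this is a binary form, and l
    is assembled from such forms. Radicality of I enters twice. It keeps J from lying in (p) after p
    is divided out, so that (p) is an associated prime of pJ; and it keeps the irrelevant ideal from
    being associated to J unless J contains all variables. For nonzero I, the final D is the sum of
    s, which does not depend on n, and a degree bound for each prime divided out. *)

(** * Prime elements and factorization into primes *)

Definition multiples (R : comNzRingType) (p : R) : set R :=
  [set a | exists c, a = c * p].

Definition prime_elt (R : comNzRingType) (p : R) :=
  p != 0 /\ is_prime (multiples p).

(** The factors are prime rather than irreducible, so [f] determines the length of [s], which serves
    as induction measure whenever a prime is divided out. *)
Definition factors_into (R : idomainType) (f : R) (s : seq R) :=
  (forall p, p \in s -> prime_elt p) /\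
  exists2 u, u \is a GRing.unit & f = u * \prod_(p <- s) p.

Definition factorial_ring (R : idomainType) :=
  forall f : R, f != 0 -> exists s, factors_into f s.

Section Multiples.
Variable R : comNzRingType.
Implicit Types p a b : R.

Lemma multiples_ideal p : is_ideal (multiples p).
Proof.
split=> [|a b [c ->] [d ->]|a b [c ->]]; first by exists 0; rewrite mul0r.
  by exists (c + d); rewrite mulrDl.
by exists (a * c); rewrite mulrA.
Qed.

Lemma multiplesD p a b : multiples p a -> multiples p b -> multiples p (a + b).
Proof. by case: (multiples_ideal p) => _ h _; exact: h. Qed.

Lemma multiplesMr p a b : multiples p b -> multiples p (a * b).
Proof. by case: (multiples_ideal p) => _ _; exact. Qed.

Lemma multiplesMl p a b : multiples p a -> multiples p (a * b).
Proof. by rewrite mulrC; apply: multiplesMr. Qed.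

Lemma multiples_id p : multiples p p.
Proof. by exists 1; rewrite mul1r. Qed.

Lemma multiplesB p a b : multiples p a -> multiples p b -> multiples p (a - b).
Proof. by move=> pa [c ->]; rewrite -mulNr; apply: multiplesD => //; exists (- c). Qed.

Lemma prime_eltM p a b : prime_elt p ->
  multiples p (a * b) -> multiples p a \/ multiples p b.
Proof. by case=> _ [_ _]; apply. Qed.

End Multiples.

Section Factorization.
Variable R : idomainType.
Implicit Types (p f g u : R) (s : seq R).

Lemma factors_unit u : u \is a GRing.unit -> factors_into u [::].
Proof. by move=> uU; split=> //; exists u; rewrite // big_nil mulr1. Qed.

Lemma factors_prime p : prime_elt p -> factors_into p [:: p].
Proof.
move=> pp; split=> [q|]; first by rewrite inE => /eqP->.
by exists 1; rewrite ?unitr1 // big_seq1 mul1r.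
Qed.

Lemma factorsM f g s t :
  factors_into f s -> factors_into g t -> factors_into (f * g) (s ++ t).
Proof.
move=> [ps [u uU ->]] [pt [v vU ->]]; split=> [p|].
  by rewrite mem_cat => /orP[/ps|/pt].
by exists (u * v); rewrite ?unitrM ?uU // big_cat /= mulrACA.
Qed.

Lemma prime_elt_unit p u : prime_elt p -> u \is a GRing.unit -> ~ multiples p u.
Proof.
move=> [_ [_ p1 _]] uU [c e]; apply: p1; exists (u^-1 * c).
by rewrite -mulrA -e mulVr.
Qed.

(** By primality [p] divides some [q] in [s], say [q = c * p]; as [q] is prime too and [p] is not a
    unit, [c] is a unit. Dividing by a prime thus shortens the list by exactly one. *)
Lemma factors_div f g p s : prime_elt p -> f = g * p -> factors_into f s ->
  exists2 t, size s = (size t).+1 & factors_into g t.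
Proof.
move=> pp; elim: s f g => [|q s IHs] f g fE [ps [u uU]].
  rewrite big_nil mulr1 => fu.
  by case: (prime_elt_unit pp uU); exists g; rewrite -fu.
rewrite big_cons => fu; have p0 : p != 0 by case: pp.
have pq : prime_elt q by apply: ps; rewrite inE eqxx.
have ps' r : r \in s -> prime_elt r by move=> rs; apply: ps; rewrite inE rs orbT.
have [|[c qE]|[c cE]] := @prime_eltM _ p q (u * \prod_(r <- s) r) pp.
- by exists g; rewrite -fE fu mulrCA.
- exists s => //; split=> //; exists (u * c).
    rewrite unitrM uU /=; have [[d cE]|[d pE]] : multiples q c \/ multiples q p.
    + by apply: prime_eltM => //; exists 1; rewrite mul1r.
    + have q0 : q != 0 by case: pq.
      have := qE; rewrite cE -[LHS]mul1r -mulrA [q * p]mulrC mulrA => /(mulIf q0) e1.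
      by case: pp => _ [_ []]; exists d.
    + have := pE; rewrite qE mulrA -[LHS]mul1r => /(mulIf p0) dc.
      by apply/unitrPr; exists d; rewrite mulrC -dc.
  by apply: (mulIf p0); rewrite -fE fu qE; ring.
- have [t ss [pt [v vU vE]]] := IHs _ _ cE (conj ps' (ex_intro2 _ _ u uU erefl)).
  exists (q :: t); first by rewrite /= ss.
  split=> [r|]; first by rewrite inE => /orP[/eqP->//|/pt].
  exists v => //; rewrite big_cons; apply: (mulIf p0).
  by rewrite -fE fu mulrCA cE vE; ring.
Qed.

End Factorization.
(** * Gauss's lemma *)

Section Gauss.
Variable R : idomainType.
Implicit Types (p c : R) (f g q d : {poly R}) (s : seq R).

Lemma multiples_polyC_mulX p f : multiples p%:P (f * 'X) -> multiples p%:P f.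
Proof.
case=> h; elim/poly_ind: h => [|h c _] e.
  exists 0; apply: (mulIf (negbT (polyX_eq0 R))); by rewrite e !mul0r.
have := congr1 (coefp 0) e; rewrite /= coefMX /= coefMC coefD coefMX coefC /= add0r.
move=> cp; exists h; apply: (mulIf (negbT (polyX_eq0 R))); rewrite e mulrDl -polyCM -cp.
by rewrite polyC0 addr0 mulrAC.
Qed.

Lemma multiples_polyC p c : multiples p%:P c%:P <-> multiples p c.
Proof.
split=> [[h e]|[b ->]]; last by exists b%:P; rewrite polyCM.
by exists h`_0; rewrite -coefMC -e coefC.
Qed.

Lemma multiples_MXaddC p f c :
  multiples p%:P (f * 'X + c%:P) -> multiples p c /\ multiples p%:P f.
Proof.
case=> h e; have pc : multiples p c.
  exists h`_0; have := congr1 (coefp 0) e.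
  by rewrite /= coefD coefMX coefC add0r coefMC.
split=> //; apply: multiples_polyC_mulX.
rewrite -[_ * _](addrK c%:P); apply: multiplesB; first by exists h.
exact/multiples_polyC.
Qed.

(** Induction on both factors in Horner form: [p] divides the product of the constant terms, hence
    one of them; subtracting the multiple of [p] that this term contributes leaves a product from
    which ['X] cancels. *)
Lemma prime_polyC p : prime_elt p -> prime_elt p%:P.
Proof.
move=> pp; have [p0 [_ p1 _]] := pp; split; first by rewrite polyC_eq0.
split; first exact: multiples_ideal.
  by rewrite -[1]/(1%:P) => /multiples_polyC.
elim/poly_ind=> [|f c IHf]; first by move=> g _; left; exists 0; rewrite mul0r.
elim/poly_ind=> [|g e IHg] h; first by right; exists 0; rewrite mul0r.
have hc : multiples p (c * e).
  have [|//] := @multiples_MXaddC p (f * (g * 'X + e%:P) + c%:P * g) (c * e).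
  by move: h; congr (multiples _ _); rewrite polyCM; ring.
have [pc|pe] := prime_eltM pp hc.
- have pfg : multiples p%:P (f * (g * 'X + e%:P)).
    apply: multiples_polyC_mulX.
    rewrite [X in multiples _ X](_ : _ = (f * 'X + c%:P) * (g * 'X + e%:P)
                          - c%:P * (g * 'X + e%:P)); last by ring.
    by apply: multiplesB => //; apply: multiplesMl; apply/multiples_polyC.
  have [pf|] := IHf _ pfg; [left|by right].
  by apply: multiplesD; [exact: multiplesMl|exact/multiples_polyC].
- have pfg : multiples p%:P ((f * 'X + c%:P) * g).
    apply: multiples_polyC_mulX.
    rewrite [X in multiples _ X](_ : _ = (f * 'X + c%:P) * (g * 'X + e%:P)
                          - (f * 'X + c%:P) * e%:P); last by ring.
    by apply: multiplesB => //; apply: multiplesMr; apply/multiples_polyC.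
  have [|pg] := IHg pfg; [by left|right].
  by apply: multiplesD; [exact: multiplesMl|exact/multiples_polyC].
Qed.

Lemma factors_polyC c s : factors_into c s ->
  factors_into c%:P [seq p%:P | p <- s].
Proof.
move=> [ps [u uU ->]]; split=> [q /mapP[p /ps pp ->]|]; first exact: prime_polyC.
by exists u%:P; rewrite ?rmorph_unit // polyCM big_map rmorph_prod.
Qed.

Definition primitive_poly f := forall p, prime_elt p -> ~ multiples p%:P f.

(** The primes of [c] are removed one at a time: each divides [q * f] but not the primitive [f],
    hence divides [q]. *)
Lemma primitive_cancel s c f g q : factors_into c s -> primitive_poly f ->
  c%:P * g = q * f -> exists q', g = q' * f.
Proof.
move=> fs pf; elim: s c q fs => [|p s IHs] c q [ps [u uU ->]].
  rewrite big_nil mulr1 => e; exists (u^-1%:P * q).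
  by rewrite -mulrA -e mulrA -polyCM mulVr // mul1r.
rewrite big_cons => e.
have pp : prime_elt p by apply: ps; rewrite inE eqxx.
have [|[q' qE]|/(pf _ pp)//] := @prime_eltM _ p%:P q f (prime_polyC pp).
  by rewrite -e mulrCA polyCM -mulrA; apply: multiplesMl; apply: multiples_id.
apply: (IHs (u * \prod_(r <- s) r) q').
  split=> [r rs|]; [by apply: ps; rewrite inE rs orbT|by exists u].
have p0 : p%:P != 0 by rewrite polyC_eq0; case: pp.
by apply: (mulfI p0); rewrite mulrA -polyCM mulrCA e qE; ring.
Qed.

(** A factorization of [f] over the fraction field, with denominator [c], descends to [R] with the
    same degrees, since each prime of [c] cancels from [q] or from [d]. *)
Lemma split_cancel s c f q d : factors_into c s -> c%:P * f = q * d ->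
  exists q' d', [/\ f = q' * d', size q' = size q & size d' = size d].
Proof.
elim: s c q d => [|p s IHs] c q d [ps [u uU ->]].
  rewrite big_nil mulr1 => e; exists (u^-1%:P * q), d; split=> //.
    by rewrite -mulrA -e mulrA -polyCM mulVr // mul1r.
  rewrite mul_polyC size_scale // invr_neq0 //.
  by apply: contraTneq uU => ->; rewrite unitr0.
rewrite big_cons => e.
have pp : prime_elt p by apply: ps; rewrite inE eqxx.
have p0 : p != 0 by case: pp.
have p0' : p%:P != 0 by rewrite polyC_eq0.
have fs : factors_into (u * \prod_(r <- s) r) s.
  split=> [r rs|]; [by apply: ps; rewrite inE rs orbT|by exists u].
have [||] := @prime_eltM _ p%:P q d (prime_polyC pp).
- by rewrite -e mulrCA polyCM -mulrA; apply: multiplesMl; apply: multiples_id.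
- move=> [q1 qE]; have [|q' [d' [fE sq sd]]] := IHs _ q1 d fs.
    by apply: (mulfI p0'); rewrite mulrA -polyCM mulrCA e qE; ring.
  by exists q', d'; split=> //; rewrite sq qE mulrC mul_polyC size_scale.
- move=> [d1 dE]; have [|q' [d' [fE sq sd]]] := IHs _ q d1 fs.
    by apply: (mulfI p0'); rewrite mulrA -polyCM mulrCA e dE; ring.
  by exists q', d'; split=> //; rewrite sd dE mulrC mul_polyC size_scale.
Qed.

Hypothesis facR : factorial_ring R.

(** The gcd of [f] and [g] over the fraction field descends to a factor of [f] over [R] by
    [split_cancel]. Either it is constant, and [f] divides [h], or its cofactor is constant, and [f]
    divides [g]. *)
Lemma prime_poly_irreducible f : f != 0 -> (1 < size f)%N -> primitive_poly f ->
  (forall q d, f = q * d -> (size q <= 1)%N \/ (size d <= 1)%N) -> prime_elt f.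
Proof.
move=> f0 sf pf irrf; split=> //; split; first exact: multiples_ideal.
  case=> c e; have : (size f <= size (1%R : {poly R}))%N.
    apply: dvdp_leq; first exact: oner_neq0.
    by apply/Pdiv.Idomain.dvdpP; exists (1, c); rewrite ?oner_eq0 //= scale1r.
  by rewrite size_poly1 leqNgt sf.
move=> g h [c e].
(* The relation [%|] is divisibility up to a nonzero scalar, that is, over the fraction field;
   [dvdM] removes the scalar because [f] is primitive. *)
have fgh : f %| g * h.
  by apply/Pdiv.Idomain.dvdpP; exists (1, c); rewrite ?oner_eq0 //= scale1r.
have dvdM k : f %| k -> multiples f k.
  move/Pdiv.Idomain.dvdpP=> [[b q] /= b0 kE].
  have [s bs] := facR b0.
  by apply: (primitive_cancel bs pf (q := q)); rewrite mul_polyC.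
suff [/Gauss_dvdpr cfg|/dvdM fg] : coprimep f g \/ f %| g; [|by left|].
  by right; apply: dvdM; rewrite -cfg.
have /Pdiv.Idomain.dvdpP[[b q] /= b0 fE] := dvdp_gcdl f g.
have [s bs] := facR b0.
have [|q' [d' [/irrf fqd sq sd]]] := @split_cancel s b f q (gcdp f g) bs.
  by rewrite mul_polyC.
have g0 : gcdp f g != 0 by rewrite gcdp_eq0 negb_and f0.
case: fqd => [sq1|sd1]; [right|left].
  have q0 : q != 0.
    apply: contraNneq f0 => q0; rewrite -(inj_eq (mulfI (_ : b%:P != 0))) ?polyC_eq0 //.
    by rewrite mulr0 mul_polyC fE q0 mul0r.
  have /size_poly1P[a a0 qa] : size q == 1%N.
    by rewrite eqn_leq -sq sq1 sq lt0n size_poly_eq0.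
  apply: dvdp_trans (dvdp_gcdr f g); apply/Pdiv.Idomain.dvdpP.
  by exists (a, b%:P) => //=; rewrite mul_polyC fE qa mul_polyC.
by rewrite coprimep_def eqn_leq -sd sd1 sd lt0n size_poly_eq0.
Qed.

(** A prime constant dividing [f] divides its leading coefficient, whose number of prime factors
    bounds how often this can be repeated. *)
Lemma primitive_part f : f != 0 -> exists c g,
  [/\ c != 0, primitive_poly g & f = c%:P * g].
Proof.
move=> f0; have lf0 : lead_coef f != 0 by rewrite lead_coef_eq0.
have [s fs] := facR lf0; have [n] := ubnP (size s); elim: n => // n IHn in s f f0 lf0 fs *.
move=> sn; have [pf|] := pselect (primitive_poly f).
  by exists 1, f; rewrite oner_neq0 mul1r.
move=> /existsNP[p /not_implyP[pp /contrapT[g fE]]].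
have lE : lead_coef f = lead_coef g * p by rewrite fE lead_coefM lead_coefC.
have [t st gt] := factors_div pp lE fs.
have lg0 : lead_coef g != 0 by apply: contraNneq lf0; rewrite lE => ->; rewrite mul0r.
have g0 : g != 0 by rewrite -lead_coef_eq0.
have [|c [h [c0 ph gE]]] := IHn t g g0 lg0 gt; first by rewrite -st.
exists (p * c), h; split=> //; first by rewrite mulf_neq0 //; case: pp.
by rewrite fE gE polyCM; ring.
Qed.

Lemma factorial_poly : factorial_ring {poly R}.
Proof.
move=> f; have [n] := ubnP (size f); elim: n => // n IHn in f *; move=> sf f0.
have [sf1|sf1] := leqP (size f) 1.
  have fC := size1_polyC sf1.
  have [|s fs] := @facR f`_0; first by rewrite -polyC_eq0 -fC.
  by exists [seq p%:P | p <- s]; rewrite fC; apply: factors_polyC.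
have [c [g [c0 pg fE]]] := primitive_part f0.
have [s cs] := facR c0.
have sfg : size f = size g by rewrite fE mul_polyC size_scale.
have g0 : g != 0 by rewrite -size_poly_eq0 -sfg size_poly_eq0.
suff [t gt] : exists t, factors_into g t.
  exists ([seq p%:P | p <- s] ++ t); rewrite fE; apply: factorsM => //.
  exact: factors_polyC.
have [irrg|] :=
  pselect (forall q d, g = q * d -> (size q <= 1)%N \/ (size d <= 1)%N).
  by exists [:: g]; apply: factors_prime; apply: prime_poly_irreducible; rewrite -?sfg.
move=> /existsNP[q /existsNP[d /not_implyP[gE /not_orP[/negP sq /negP sd]]]].
have [q0 d0] : q != 0 /\ d != 0.
  by apply/andP; rewrite -negb_or -mulf_eq0 -gE.
have sqd : size g = (size q + size d).-1 by rewrite gE size_mul.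
rewrite -!ltnNge in sq sd; rewrite ltnS sfg sqd in sf.
have [||t1 qt] := IHn q => //; first by lia.
have [||t2 dt] := IHn d => //; first by lia.
by exists (t1 ++ t2); rewrite gE; apply: factorsM.
Qed.

End Gauss.
(** * Multivariate polynomials *)

Section Isomorphism.
Variables (R S : idomainType) (psi : {rmorphism R -> S}) (phi : S -> R).
Hypotheses (psiK : cancel psi phi) (phiK : cancel phi psi).

Lemma multiples_iso p a : multiples (psi p) (psi a) <-> multiples p a.
Proof.
split=> [[c e]|[c ->]]; last by exists (psi c); rewrite rmorphM.
by exists (phi c); apply: (can_inj psiK); rewrite rmorphM /= phiK.
Qed.

Lemma prime_elt_iso p : prime_elt p -> prime_elt (psi p).
Proof.
move=> [p0 [_ p1 pM]]; split.
  by rewrite -(rmorph0 psi) (inj_eq (can_inj psiK)).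
split; first exact: multiples_ideal.
  by rewrite -(rmorph1 psi) => /multiples_iso.
by move=> a b; rewrite -[a]phiK -[b]phiK -rmorphM !multiples_iso; apply: pM.
Qed.

Lemma factorial_iso : factorial_ring R -> factorial_ring S.
Proof.
move=> facR f f0; have [|s [ps [u uU fE]]] := facR (phi f).
  by apply: contraNneq f0 => e; rewrite -[f]phiK e rmorph0.
exists [seq psi p | p <- s]; split=> [q /mapP[p /ps pp ->]|].
  exact: prime_elt_iso.
exists (psi u); first exact: rmorph_unit.
by rewrite big_map -rmorph_prod -rmorphM /= -fE phiK.
Qed.

End Isomorphism.

Lemma mpoly_rmorph_ext (n : nat) (R : comNzRingType) (S : comNzRingType)
    (g h : {rmorphism {mpoly R[n]} -> S}) :
  (forall c, g c%:MP = h c%:MP) -> (forall i, g 'X_i = h 'X_i) -> g =1 h.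
Proof.
move=> eC eX p; rewrite [p]mpolyE !rmorph_sum /=; apply: eq_bigr => m _.
rewrite -mul_mpolyC !rmorphM /= eC mpolyXE_id !rmorph_prod /=; congr (_ * _).
by apply: eq_bigr => i _; rewrite !rmorphXn /= eX.
Qed.

Section MpolyUni.
Variables (n : nat) (R : idomainType).
Implicit Types (q : {poly {mpoly R[n]}}) (f : {mpoly R[n.+1]}).

(** Inverse of [muni], in the direction in which [factorial_iso] transports factorizations. *)
Definition mpoly_of_uni q : {mpoly R[n.+1]} :=
  (map_poly (@mwiden n R) q).['X_ord_max].

Lemma mpoly_of_uni_is_additive : additive mpoly_of_uni.
Proof. by move=> p q; rewrite /mpoly_of_uni rmorphB /= hornerD hornerN. Qed.

Lemma mpoly_of_uni_is_multiplicative : multiplicative mpoly_of_uni.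
Proof.
by split=> [p q|]; rewrite /mpoly_of_uni ?rmorph1 ?rmorphM /= ?hornerM ?hornerC.
Qed.

HB.instance Definition _ :=
  GRing.isAdditive.Build _ _ mpoly_of_uni mpoly_of_uni_is_additive.
HB.instance Definition _ :=
  GRing.isMultiplicative.Build _ _ mpoly_of_uni mpoly_of_uni_is_multiplicative.

Lemma mpoly_of_uniC c : mpoly_of_uni c%:P = mwiden c.
Proof. by rewrite /mpoly_of_uni map_polyC hornerC. Qed.

Lemma mpoly_of_uniX : mpoly_of_uni 'X = 'X_ord_max.
Proof. by rewrite /mpoly_of_uni map_polyX hornerX. Qed.

Lemma muniXmax : muni 'X_ord_max = 'X :> {poly {mpoly R[n]}}.
Proof.
rewrite /muni mmapX mmap1U; case: splitP => //= j.
by move=> e; have := ltn_ord j; rewrite -e ltnn.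
Qed.

Lemma muniXwiden (i : 'I_n) :
  muni 'X_(widen_ord (leqnSn n) i) = ('X_i)%:P :> {poly {mpoly R[n]}}.
Proof.
rewrite /muni mmapX mmap1U; case: splitP => [j|j] /= e; last first.
  by have := ltn_ord i; rewrite e ord1 /= addn0 ltnn.
by congr ('X__)%:P; apply/val_inj.
Qed.

Lemma muni_mwiden (c : {mpoly R[n]}) : muni (mwiden c) = c%:P.
Proof.
apply: (@mpoly_rmorph_ext n R _ (@muni n R \o @mwiden n R) polyC) => [a|i] /=.
  by rewrite mwidenC muniC.
by rewrite mwidenX mnmwiden1 muniXwiden.
Qed.

Lemma mpoly_of_uniK : cancel mpoly_of_uni (@muni n R).
Proof.
elim/poly_ind=> [|q c IHq]; first by rewrite !rmorph0.
by rewrite rmorphD rmorphM /= mpoly_of_uniC mpoly_of_uniX muniD muniM IHq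
           muni_mwiden muniXmax.
Qed.

Lemma muniK : cancel (@muni n R) mpoly_of_uni.
Proof.
apply: (@mpoly_rmorph_ext n.+1 R _ (mpoly_of_uni \o @muni n R) idfun) => [a|i] /=.
  by rewrite muniC mpoly_of_uniC mwidenC.
have [j ->|->] := unliftP ord_max i; last by rewrite muniXmax mpoly_of_uniX.
have -> : lift ord_max j = widen_ord (leqnSn n) j.
  by apply: val_inj; rewrite /= /bump leqNgt ltn_ord.
by rewrite muniXwiden mpoly_of_uniC mwidenX mnmwiden1.
Qed.

End MpolyUni.

Lemma factorial_mpoly (K : fieldType) n : factorial_ring {mpoly K[n]}.
Proof.
elim: n => [|n IHn]; last first.
  exact: factorial_iso (@mpoly_of_uniK n K) (@muniK n K) (factorial_poly IHn).
apply: (@factorial_iso K {mpoly K[0]} (@mpolyC 0 K) (mcoeff 0%MM)).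
- by move=> c; rewrite mcoeffC eqxx mulr1.
- by move=> f; apply/mpolyP=> m; rewrite mcoeffC; have -> : m = 0%MM by [
    apply/mnmP=> -[]]; rewrite eqxx mulr1.
- by move=> f f0; exists [::]; apply: factors_unit; rewrite unitfE.
Qed.

(** * Elimination of the indeterminate from an ideal of R[X] *)

Section Elimination.
Variable R : idomainType.
Hypothesis facR : factorial_ring R.

(** If [q] has positive degree, it is coprime to [g] over the fraction field, and a Bezout relation
    with cleared denominators gives [c]. A constant [q] is its own [c]. *)
Lemma prime_elt_elim (q g : {poly R}) : prime_elt q -> ~ multiples q g ->
  exists c a b, c != 0 /\ c%:P = a * q + b * g.
Proof.
move=> pq qg; have [q0 [_ _ _]] := pq.
have [sq|sq] := leqP (size q) 1.
  exists q`_0, 1, 0; rewrite mul1r mul0r addr0 -(size1_polyC sq); split=> //.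
  by rewrite -polyC_eq0 -(size1_polyC sq).
have cq : coprimep q g.
  have qC b : b != 0 -> ~ multiples q b%:P.
    move=> b0 [h e]; have : (size q <= size (b%:P))%N.
      apply: dvdp_leq; first by rewrite polyC_eq0.
      by apply/Pdiv.Idomain.dvdpP; exists (1, h); rewrite ?oner_eq0 //= scale1r.
    by rewrite size_polyC b0 leqNgt sq.
  apply/coprimepP => d /Pdiv.Idomain.dvdpP[[c h] /= c0 e] dg.
  have [|[h' hE]|[d' dE]] := @prime_eltM _ q h d pq.
  - by rewrite -e -mul_polyC; apply: multiplesMr; apply: multiples_id.
  - have cE : c%:P = h' * d.
      by apply: (mulIf q0); rewrite mul_polyC e hE; ring.
    rewrite -size_poly_eq1; have : h' != 0 /\ d != 0.
      by apply/andP; rewrite -negb_or -mulf_eq0 -cE polyC_eq0.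
    move=> [h0 d0]; have := size_mul h0 d0; rewrite -cE size_polyC c0 => sE.
    move: h0 d0 sE; rewrite -!size_poly_gt0.
    by case: (size h') => [|[|?]]; case: (size d) => [|[|?]] //=; rewrite ?addnS ?addSn.
  - have /Pdiv.Idomain.dvdpP[[b r] /= b0 gE] := dg.
    have [|/(qC _ b0)//|/qg//] := @prime_eltM _ q b%:P g pq.
    by rewrite mul_polyC gE dE mulrA; exists (r * d').
have /Bezout_coprimepP[[a b] /=] := cq.
rewrite -size_poly_eq1 => /size_poly1P[c c0 e].
by exists c, a, b; rewrite -e.
Qed.

(** For each prime factor [p] of [f], some [g] in [J] gives a nonzero constant in (p, g). The
    product of these constants is, modulo [J], a multiple of the product of the primes, which is in
    [J]. *)
Lemma elim_ideal (J : set {poly R}) f : is_ideal J -> J f -> f != 0 ->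
  (forall q, prime_elt q -> exists2 g, J g & ~ multiples q g) ->
  exists2 c, c != 0 & J c%:P.
Proof.
move=> [J0 JD JM] Jf f0 npJ.
have [s [ps [u uU fE]]] := factorial_poly facR f0.
have {fE} Jp : J (\prod_(p <- s) p).
  by rewrite -[\prod_(_ <- _) _](mulKr uU) -fE; apply: JM.
suff [c [a [j [c0 Jj e]]]] : exists c a j,
    [/\ c != 0, J j & c%:P = a * (\prod_(p <- s) p) + j].
  by exists c => //; rewrite e; apply: JD => //; apply: JM.
elim: s ps {Jp} => [|p s IHs] ps.
  by exists 1, 1, 0; rewrite oner_neq0 big_nil mulr1 addr0.
have [|c [a [j [c0 Jj e]]]] := IHs; first by move=> q qs; apply: ps; rewrite inE qs orbT.
have pp : prime_elt p by apply: ps; rewrite inE eqxx.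
have [g Jg pg] := npJ p pp.
have [d [x [y [d0 dE]]]] := prime_elt_elim pp pg.
exists (d * c), (x * a), (x * p * j + y * g * c%:P); split.
- by rewrite mulf_neq0.
- by apply: JD; [exact: JM|rewrite mulrAC; apply: JM].
- by rewrite big_cons polyCM dE mulrDl {1}e; ring.
Qed.

End Elimination.

(** * Ideals and symbolic powers *)

Section Ideals.
Variable R : comNzRingType.
Implicit Types (I J P S : set R) (f g : R) (n : nat).

Lemma ideal_sum I (T : Type) (r : seq T) (F : T -> R) :
  is_ideal I -> (forall i, I (F i)) -> I (\sum_(i <- r) F i).
Proof.
move=> [I0 ID _] IF; elim: r => [|i r IHr]; first by rewrite big_nil.
by rewrite big_cons; apply: ID.
Qed.

Lemma idealMl I f g : is_ideal I -> I f -> I (f * g).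
Proof. by case=> _ _ IM If; rewrite mulrC; apply: IM. Qed.

Lemma idealN I f : is_ideal I -> I f -> I (- f).
Proof. by case=> _ _ IM If; rewrite -mulN1r; apply: IM. Qed.

Lemma idealB I f g : is_ideal I -> I f -> I g -> I (f - g).
Proof. by move=> iI If Ig; case: (iI) => _ ID _; apply: ID => //; apply: idealN. Qed.

Lemma idealDr I f g : is_ideal I -> I f -> I (f + g) -> I g.
Proof. by move=> iI If Ifg; rewrite -[g](addKr f) addrC; apply: idealB. Qed.

Lemma prime_prod P n (g : 'I_n -> R) :
  is_prime P -> (forall i, ~ P (g i)) -> ~ P (\prod_(i < n) g i).
Proof.
move=> [_ P1 PM] Pg; elim/big_ind: _ => // a b Pa Pb /PM[]; [exact: Pa|exact: Pb].
Qed.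

Lemma prime_expn P f n : is_prime P -> P (f ^+ n) -> P f.
Proof.
move=> [_ P1 PM]; elim: n => [|n IHn]; first by rewrite expr0.
by rewrite exprS => /PM[].
Qed.

Definition radical_of I : set R := [set f : R | exists n, I (f ^+ n)].

Lemma radical_of_ideal I : is_ideal I -> is_ideal (radical_of I).
Proof.
move=> iI; have [I0 ID IM] := iI; split=> [|f g [n fn] [m gm]|a f [n fn]].
- by exists 1; rewrite expr1.
- exists (n + m)%N; rewrite exprDn; apply: ideal_sum => // i.
  rewrite -mulr_natl; apply: (IM).
  have [im|im] := leqP m i; first by rewrite -(subnK im) exprD mulrA; apply: IM.
  have -> : (n + m - i = n + (m - i))%N by rewrite addnBA // ltnW.
  by rewrite exprD -mulrA; apply: idealMl.
- by exists n; rewrite exprMn; apply: IM.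
Qed.

Lemma radical_of_radical I : is_radical (radical_of I).
Proof. by move=> f n [m]; rewrite -exprM; exists (n * m)%N. Qed.

Lemma sub_radical_of I : I `<=` radical_of I.
Proof. by move=> f If; exists 1; rewrite expr1. Qed.

Definition ideal_add I (l : R) : set R :=
  [set f : R | exists j c, I j /\ f = j + l * c].

Lemma ideal_add_ideal I l : is_ideal I -> is_ideal (ideal_add I l).
Proof.
case=> I0 ID IM; split=> [|f g [j [c [Ij ->]]] [k [d [Ik ->]]]|a f [j [c [Ij ->]]]].
- by exists 0, 0; rewrite mulr0 addr0.
- by exists (j + k), (c + d); split; [exact: ID|rewrite mulrDr addrACA].
- by exists (a * j), (a * c); split; [exact: IM|rewrite mulrDr mulrCA].
Qed.

Lemma ideal_gen_ideal S : is_ideal (ideal_gen S).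
Proof.
split=> [|f f' [m [a [g [Sg ->]]]] [m' [a' [g' [Sg' ->]]]]|b f [m [a [g [Sg ->]]]]].
- exists 0, (fun=> 0), (fun=> 0); split; first by case.
  by rewrite big_ord0.
- exists (m + m')%N.
  exists (fun i => match split i with inl j => a j | inr j => a' j end).
  exists (fun i => match split i with inl j => g j | inr j => g' j end).
  split=> [i|]; first by case: split.
  rewrite big_split_ord /=; congr (_ + _); apply: eq_bigr => i _.
    by rewrite (unsplitK (inl i)).
  by rewrite (unsplitK (inr i)).
- exists m, (fun i => b * a i), g; split=> //.
  by rewrite mulr_sumr; apply: eq_bigr => i _; rewrite mulrA.
Qed.

Lemma sub_ideal_gen S : S `<=` ideal_gen S.
Proof.
move=> f Sf; exists 1, (fun=> 1), (fun=> f); split=> //.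
by rewrite big_ord1 mul1r.
Qed.

Lemma ideal_gen_min S I : is_ideal I -> S `<=` I -> ideal_gen S `<=` I.
Proof.
move=> iI SI f [m [a [g [Sg ->]]]]; apply: ideal_sum => // i.
by case: iI => _ _; apply; apply: SI.
Qed.

Lemma ideal_exp_ideal I n : is_ideal (ideal_exp I n).
Proof. exact: ideal_gen_ideal. Qed.

Lemma ideal_exp_prod I n (g : 'I_n -> R) :
  (forall i, I (g i)) -> ideal_exp I n (\prod_(i < n) g i).
Proof. by move=> Ig; apply: sub_ideal_gen; exists g. Qed.

Lemma ideal_exp_min I J n : is_ideal J ->
  (forall g : 'I_n -> R, (forall i, I (g i)) -> J (\prod_(i < n) g i)) ->
  ideal_exp I n `<=` J.
Proof. by move=> iJ Jg; apply: ideal_gen_min => // f [g [Ig ->]]; apply: Jg. Qed.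

Lemma ideal_expX I n f : I f -> ideal_exp I n (f ^+ n).
Proof.
move=> If; have := @ideal_exp_prod I n (fun=> f) (fun=> If).
by rewrite prodr_const card_ord.
Qed.

Lemma ideal_exp_mulr I n f g : ideal_exp I n f -> I g -> ideal_exp I n.+1 (f * g).
Proof.
move=> + Ig; move: f; apply: (@ideal_exp_min I [set f | ideal_exp I n.+1 (f * g)]).
  have [E0 ED EM] := ideal_exp_ideal I n.+1.
  split=> [|a b /= ag bg|a b /= bg] /=; first by rewrite mul0r.
    by rewrite mulrDl; apply: ED.
  by rewrite -mulrA; apply: EM.
move=> h Ih /=.
have := @ideal_exp_prod I n.+1 (fun i => oapp h g (unlift ord_max i)).
rewrite big_ord_recr /= unlift_none /= (eq_bigr h) => [|i _]; last first.
  suff -> : widen_ord (leqnSn n) i = lift ord_max i by rewrite liftK.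
  by apply: val_inj; rewrite /= /bump leqNgt ltn_ord.
by apply=> i; case: unliftP => /=.
Qed.

End Ideals.

Section SymbolicPower.
Variable R : idomainType.
Implicit Types (I J P : set R) (n : nat).

(** The product of the finitely many denominators stays outside the prime [P] and serves as [t]. All
    later arguments use this form without fractions. *)
Lemma symbolic_powerP I n h : symbolic_power I n h <->
  forall P, Ass I P -> exists2 t, ~ P t & ideal_exp I n (t * h).
Proof.
split=> hI P AP; have [Pp _] := AP; have [[P0 _ PM] P1 PMl] := Pp; last first.
  have [t Pt It] := hI P AP.
  have t0 : tofrac t != 0 by rewrite tofrac_eq0; apply/eqP => t0; rewrite t0 in Pt.
  exists 1, (fun=> (tofrac t)^-1), (fun=> t * h); split=> // [_|].
    by exists 1, t; rewrite rmorph1 div1r.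
  by rewrite big_ord1 rmorphM /= mulKf.
have [m [c [g [lc Ig hE]]]] := hI P AP.
have /choice[u uE] : forall i, exists u : R * R, ~ P u.2 /\ c i = tofrac u.1 / tofrac u.2.
  by move=> i; have [a [s ?]] := lc i; exists (a, s).
exists (\prod_(i < m) (u i).2); first by apply: prime_prod => // i; case: (uE i).
pose k i := (u i).1 * \prod_(j < m | j != i) (u j).2.
suff -> : \prod_(i < m) (u i).2 * h = \sum_(i < m) k i * g i.
  apply: ideal_sum; first exact: ideal_exp_ideal.
  by move=> i; case: (ideal_exp_ideal I n) => _ _; apply.
apply/eqP; rewrite -tofrac_eq; apply/eqP; rewrite rmorphM /= hE rmorph_sum /= mulr_sumr.
apply: eq_bigr => i _; have [Pu ->] := uE i.
have u0 : tofrac (u i).2 != 0.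
  by rewrite tofrac_eq0; apply/eqP => u0; rewrite u0 in Pu.
rewrite (bigD1 i) //= !rmorphM /=.
by rewrite mulrA; congr (_ * _); rewrite [LHS]mulrC mulrA divfK.
Qed.

Lemma symbolic_power_ideal I n : is_ideal (symbolic_power I n).
Proof.
have [E0 ED EM] := ideal_exp_ideal I n.
split=> [|f g /symbolic_powerP If /symbolic_powerP Ig|a f /symbolic_powerP If];
    apply/symbolic_powerP => P AP; have [Pp _] := AP; have [[P0 _ PM] P1 PMl] := Pp.
- by exists 1; rewrite ?mulr0.
- have [s Ps sf] := If P AP; have [t Pt tg] := Ig P AP.
  exists (s * t); first by move=> /PMl[].
  rewrite mulrDr; apply: ED; first by rewrite mulrAC mulrC; apply: EM.
  by rewrite -mulrA; apply: EM.
- by have [s Ps sf] := If P AP; exists s; rewrite // mulrCA; apply: EM.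
Qed.

Lemma ideal_exp_symbolic I n : ideal_exp I n `<=` symbolic_power I n.
Proof.
move=> f If; apply/symbolic_powerP => P [[_ P1 _] _].
by exists 1; rewrite ?mul1r.
Qed.

(** The factor [l] is absorbed into the multiplier [t], which stays outside each associated
    prime. *)
Lemma symbolic_power_cancel I n l h : (forall P, Ass I P -> ~ P l) ->
  symbolic_power I n (l * h) -> symbolic_power I n h.
Proof.
move=> lP /symbolic_powerP Ilh; apply/symbolic_powerP => P AP.
have [t Pt It] := Ilh P AP; exists (t * l); last by rewrite -mulrA.
by case: (AP) => -[_ _ PM] _ /PM[|/lP]//; exact.
Qed.

End SymbolicPower.
(** * Dividing out a prime element *)

Section ScaledIdeal.
Variable R : idomainType.
Implicit Types (I J P : set R) (p f g : R) (n : nat).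

Definition scaled p J : set R := [set f : R | exists2 j, J j & f = p * j].

Lemma scaled_ideal p J : is_ideal J -> is_ideal (scaled p J).
Proof.
move=> [J0 JD JM]; split=> [|f g [j Jj ->] [k Jk ->]|a f [j Jj ->]].
- by exists 0; rewrite ?mulr0.
- by exists (j + k); [exact: JD|rewrite mulrDr].
- by exists (a * j); [exact: JM|rewrite mulrCA].
Qed.

Lemma scaledM p J f : p != 0 -> scaled p J (p * f) <-> J f.
Proof. by move=> p0; split=> [[j Jj /(mulfI p0)->]|Jf] //; exists f. Qed.

Lemma ideal_exp_scaled p J n : p != 0 ->
  ideal_exp (scaled p J) n = scaled (p ^+ n) (ideal_exp J n).
Proof.
move=> p0; have prodE (F : 'I_n -> R) : \prod_i (p * F i) = p ^+ n * \prod_i F i.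
  by rewrite big_split prodr_const card_ord.
apply/seteqP; split.
  apply: ideal_exp_min; first by apply: scaled_ideal; apply: ideal_exp_ideal.
  move=> g sg; have /choice[j jE] : forall i, exists j, J j /\ g i = p * j.
    by move=> i; have [j] := sg i; exists j.
  exists (\prod_(i < n) j i); first by apply: ideal_exp_prod => i; case: (jE i).
  rewrite -prodE; apply: eq_bigr => i _; by case: (jE i).
move=> f [h Jh ->]; move: h Jh.
apply: (@ideal_exp_min _ J [set h | ideal_exp (scaled p J) n (p ^+ n * h)]).
  have [E0 ED EM] := ideal_exp_ideal (scaled p J) n.
  split=> [|a b /= Ja Jb|a b /= Ja] /=; first by rewrite mulr0.
    by rewrite mulrDr; apply: ED.
  by rewrite mulrCA; apply: EM.
move=> g Jg /=; rewrite -prodE.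
by apply: ideal_exp_prod => i /=; exists (g i).
Qed.

Lemma prime_expn_div p n t h : prime_elt p -> ~ multiples p t ->
  multiples (p ^+ n) (t * h) -> multiples (p ^+ n) h.
Proof.
move=> pp pt; elim: n h => [|n IHn] h [c hE]; first by exists h; rewrite mulr1.
have [|//|[h' h'E]] := @prime_eltM _ p t h pp.
  by exists (c * p ^+ n); rewrite -mulrA -exprSr.
have [|d dE] := IHn h'; last by exists d; rewrite h'E dE exprSr mulrA.
exists c; have p0 : p != 0 by case: pp.
by apply: (mulIf p0); rewrite -!mulrA -h'E hE exprSr.
Qed.

Lemma Ass_scaled p J f P : p != 0 -> is_prime P -> P = [set a | J (a * f)] ->
  Ass (scaled p J) P.
Proof.
move=> p0 Pp PE; split=> //; exists (p * f); rewrite PE; apply/seteqP.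
by split=> a /=; rewrite mulrCA scaledM.
Qed.

(** The associated primes of pJ are those of J together with (p). At a prime not containing J, such
    as (p), J^n localizes to the unit ideal and only p^n matters. *)
Lemma symbolic_power_scaled p J n : prime_elt p -> is_ideal J ->
    (exists2 j, J j & ~ multiples p j) ->
  symbolic_power (scaled p J) n = scaled (p ^+ n) (symbolic_power J n).
Proof.
move=> pp iJ [j0 Jj0 pj0]; have [J0 JD JM] := iJ; have [p0 Pp] := pp.
have pn0 : p ^+ n != 0 by rewrite expf_neq0.
apply/seteqP; split=> h.
  move=> /symbolic_powerP; rewrite ideal_exp_scaled // => Ih.
  (* The ideal (p) is the annihilator of [j0] modulo pJ, since [p] divides [a * j0] only if it
     divides [a]. *)
  have [|t pt [k _ tE]] := Ih (multiples p).
    split=> //; exists j0; apply/seteqP; split=> a /=.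
      by move=> [c ->]; exists (c * j0); [exact: JM|rewrite mulrAC mulrC].
    move=> [j Jj e]; have [|//|//] := @prime_eltM _ p a j0 pp.
    by exists j; rewrite e mulrC.
  have [|h' hE] := prime_expn_div (n := n) (h := h) pp pt.
    by exists k; rewrite tE mulrC.
  exists h'; last by rewrite mulrC.
  apply/symbolic_powerP => P [Pprime [f PE]].
  have [s Ps] := Ih P (Ass_scaled p0 Pprime PE).
  by rewrite hE [h' * _]mulrC mulrCA scaledM //; exists s.
move=> [h' /symbolic_powerP Jh ->]; apply/symbolic_powerP => P [Pprime [f PE]].
rewrite ideal_exp_scaled //.
have [[j Jj Pj]|JP] := pselect (exists2 j, J j & ~ P j).
  exists (j ^+ n); first by move/(prime_expn Pprime).
  by rewrite mulrCA scaledM //; apply: idealMl; [exact: ideal_exp_ideal|exact: ideal_expX].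
(* Now [j0 * f] lies in pJ, so [p] divides [f], say [f = f' * p], and [P] is the annihilator of [f']
   modulo [J]. *)
have : P j0 by apply: contrapT => Pj0; apply: JP; exists j0.
rewrite {1}PE /= => -[j Jj e].
have [|//|[f' fE]] := @prime_eltM _ p j0 f pp; first by exists j; rewrite e mulrC.
have [|t Pt Jt] := Jh P; last first.
  by exists t => //; rewrite mulrCA scaledM.
split=> //; exists f'; rewrite PE; apply/seteqP; split=> a /=;
  by rewrite fE mulrA [_ * p]mulrC scaledM.
Qed.

End ScaledIdeal.
(** * Homogeneous components *)

(** Over the fraction field, the divisors of a power of ['X - 0] are its smaller powers up to
    scalars. *)
Lemma monomial_factor (R : idomainType) (c : R) (p q : {poly R}) d :
  c != 0 -> c *: 'X^d = p * q -> exists e, forall i, i != e -> p`_i = 0.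
Proof.
move=> c0 E; have : p %| ('X - 0%:P) ^+ d.
  rewrite subr0; apply/Pdiv.Idomain.dvdpP; exists (c, q) => //=.
  by rewrite E mulrC.
case/dvdp_exp_XsubCP => e _; rewrite subr0.
case/eqpP => -[a b] /= /andP[a0 b0] pE; exists e => i ie.
have := congr1 (coefp i) pE; rewrite /= !coefZ coefXn (negPf ie) mulr0.
by move/eqP; rewrite mulf_eq0 (negPf a0) => /eqP.
Qed.

Section Grading.
Variables (k : nat) (K : fieldType).
Implicit Types (f g h t : {mpoly K[k]}) (I J Q : set {mpoly K[k]}) (b d e n : nat).

Local Notation "f `[ d ]" := (pihomog mdeg d f) (at level 3, format "f `[ d ]").

(* The ring morphism sending each variable x to x * 'X: the coefficients of the
   image of f are the homogeneous components of f. *)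
Definition graded : {mpoly K[k]} -> {poly {mpoly K[k]}} :=
  mmap (polyC \o @mpolyC k K) (fun i => 'X_i *: 'X).

HB.instance Definition _ := GRing.isAdditive.Build _ _ graded
  (mmap_is_additive (fun i => 'X_i *: 'X) (polyC \o @mpolyC k K)).
HB.instance Definition _ := GRing.isMultiplicative.Build _ _ graded
  (mmap_is_multiplicative (fun i => 'X_i *: 'X) (polyC \o @mpolyC k K)).

Lemma graded_mono c m : graded (c *: 'X_[m]) = (c *: 'X_[m]) *: 'X^(mdeg m).
Proof.
rewrite /graded mmapZ mmapX /= -mul_mpolyC -[RHS]mul_polyC polyCM -mulrA; congr (_ * _).
rewrite /mmap1 mpolyXE_id mdegE -prodrXr rmorph_prod -big_split /=.
by apply: eq_bigr => i _; rewrite exprZn mul_polyC.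
Qed.

Lemma coef_graded f d : (graded f)`_d = f`[d].
Proof.
rewrite [f]mpolyE !raddf_sum coef_sum /=; apply: eq_bigr => m _.
rewrite graded_mono coefZ coefXn linearZ /= pihomogX eq_sym.
by case: eqP => _; rewrite ?mulr1 ?mulr0 ?scaler0.
Qed.

Lemma pihomogM f g d : (f * g)`[d] = \sum_(i < d.+1) f`[i] * g`[d - i].
Proof.
rewrite -coef_graded rmorphM /= coefM; apply: eq_bigr => i _.
by congr (_ * _); exact: coef_graded.
Qed.

Lemma mcoeff_pihomog f d m : f`[d]@_m = if mdeg m == d then f@_m else 0.
Proof.
have [dm|dm] := eqVneq (mdeg m) d; last exact: dhomog_nemf_coeff (pihomogP _ _ _) dm.
have fE := pihomog_partitionE (leq_maxl (mmeasure mdeg f) d.+1).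
have dN : (d < maxn (mmeasure mdeg f) d.+1)%N by rewrite leq_max leqnn orbT.
have -> : f@_m = \sum_(i < maxn (mmeasure mdeg f) d.+1) f`[i]@_m.
  by rewrite {1}fE (raddf_sum (mcoeff m)).
rewrite [RHS](bigD1 (Ordinal dN)) //= [X in _ + X]big1 ?addr0 // => i id.
apply: dhomog_nemf_coeff (pihomogP _ _ _) _.
by apply: contraNneq id => di; apply/eqP/val_inj; rewrite /= -di -dm.
Qed.

Lemma pihomog_homogM h f d e : h \is e.-homog ->
  (h * f)`[d] = if (e <= d)%N then h * f`[d - e] else 0.
Proof.
move=> hh; rewrite pihomogM; case: ifP => ed; last first.
  apply: big1 => i _; rewrite (pihomog_ne0 _ hh) ?mul0r //.
  by apply: contraFneq ed => ->; rewrite -ltnS.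
have ed' : (e < d.+1)%N by rewrite ltnS.
rewrite (bigD1 (Ordinal ed')) //= (pihomog_dE hh) [X in _ + X]big1 ?addr0 // => i ie.
rewrite (pihomog_ne0 _ hh) ?mul0r //.
by apply: contraNneq ie => di; apply/eqP/val_inj.
Qed.

Lemma pihomog_sum f : f = \sum_(d < msize f) f`[d].
Proof. exact: pihomog_partitionE. Qed.

(** Since [graded h] is the monomial [h *: 'X^d], its factor [graded p] has at most one nonzero
    coefficient. *)
Lemma homogeneous_factor p q h d : h \is d.-homog -> h != 0 -> h = p * q ->
  exists e, p \is e.-homog.
Proof.
move=> hh h0 hE.
have gE : h *: 'X^d = graded p * graded q.
  rewrite -rmorphM -hE; apply/polyP => i; rewrite coef_graded coefZ coefXn.
  have [->|id] := eqVneq i d; first by rewrite mulr1 pihomog_dE.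
  by rewrite mulr0 (pihomog_ne0 _ hh) // eq_sym.
have [e eP] := monomial_factor h0 gE; exists e.
apply/dhomogP => m pm; apply/eqP; apply: contraLR pm => me.
rewrite mcoeff_msupp negbK.
have -> : p@_m = p`[mdeg m]@_m by rewrite mcoeff_pihomog eqxx.
by rewrite -coef_graded eP ?mcoeff0.
Qed.

Lemma homogeneous_ideal_exp I n :
  is_ideal I -> is_homogeneous I -> is_homogeneous (ideal_exp I n).
Proof.
move=> iI hI f d If; have iIn := ideal_exp_ideal I n.
suff /(_ f If) : ideal_exp I n `<=` [set f | forall d, ideal_exp I n f`[d]] by exact.
have [E0 ED EM] := iIn; apply: ideal_exp_min.
  split=> [e|a b Ia Ib e|a b Ib e] /=; first by rewrite pihomog0.
    by rewrite pihomogD; apply: ED.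
  by rewrite pihomogM; apply: ideal_sum => // i; apply: EM.
move: {f d If iIn E0 ED EM} n; elim=> [|n IHn] g Ig d /=.
  rewrite big_ord0; have -> : (1 : {mpoly K[k]})`[d] = (1 : {mpoly K[k]})`[d] * 1.
    by rewrite mulr1.
  case: (ideal_exp_ideal I 0) => _ _; apply.
  by have := @ideal_exp_prod _ I 0 g Ig; rewrite big_ord0.
rewrite big_ord_recr /= pihomogM; apply: ideal_sum; first exact: ideal_exp_ideal.
move=> i; apply: ideal_exp_mulr; last exact: hI.
exact: IHn.
Qed.

(** Induction on d puts t_b^(d+1) f_d in [Q]: the component of t f of degree b + d is t_b f_d plus
    terms t_i f_d' with d' < d, and multiplying by t_b^d sends these terms into [Q]. *)
Lemma lowest_component_nilpotent Q t f b :
  is_ideal Q -> is_homogeneous Q -> (forall d, (d < b)%N -> t`[d] = 0) ->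
  Q (t * f) -> Q (t`[b] ^+ msize f * f).
Proof.
move=> iQ hQ tb Qtf; have [Q0 QD QM] := iQ.
have fd d : Q (t`[b] ^+ d.+1 * f`[d]).
  have [m] := ubnP d; elim: m => // m IHm in d *; rewrite ltnS => dm.
  have bd : (b < (b + d).+1)%N by rewrite ltnS leq_addr.
  have := hQ _ (b + d)%N Qtf; rewrite pihomogM (bigD1 (Ordinal bd)) //= addKn.
  move=> /(QM (t`[b] ^+ d)); rewrite mulrDr mulrA -exprSr addrC.
  apply: idealDr => //; rewrite mulr_sumr big_mkcond.
  apply: ideal_sum => // i; case: ifP => // ib.
  have [ltib|leib] := ltnP i b; first by rewrite (tb i) // mul0r mulr0.
  have ltbi : (b < i)%N by rewrite ltn_neqAle leib eq_sym ib.
  rewrite mulrCA; apply: (QM); have ltd : (b + d - i < d)%N by have := ltn_ord i; lia.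
  have -> : t`[b] ^+ d = t`[b] ^+ (d - (b + d - i).+1) * t`[b] ^+ (b + d - i).+1.
    by rewrite -exprD subnK.
  by rewrite -mulrA; apply: QM; apply: IHm; exact: leq_trans ltd dm.
rewrite [X in _ * X]pihomog_sum mulr_sumr; apply: ideal_sum => // d.
have -> : t`[b] ^+ msize f = t`[b] ^+ (msize f - d.+1) * t`[b] ^+ d.+1.
  by rewrite -exprD subnK.
by rewrite -mulrA; apply: QM.
Qed.

Lemma pihomog_expn_lowest t b n : (forall d, (d < b)%N -> t`[d] = 0) ->
  (forall d, (d < n * b)%N -> (t ^+ n)`[d] = 0) /\ (t ^+ n)`[n * b] = t`[b] ^+ n.
Proof.
move=> tb; elim: n => [|n [IH0 IHb]].
  by rewrite !expr0; split=> //; rewrite pihomog_dE ?dhomog1.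
rewrite !exprSr; split=> [d dn|]; rewrite pihomogM.
  apply: big1 => i _; have [ltib|leib] := ltnP i (n * b); first by rewrite IH0 ?mul0r.
  by rewrite [t`[_]]tb ?mulr0 //; have := ltn_ord i; rewrite mulSn in dn; lia.
have nb : (n * b < (n.+1 * b).+1)%N by rewrite ltnS leq_mul2r leqnSn orbT.
have nbE : (n.+1 * b - n * b = b)%N by rewrite mulSn addnK.
rewrite (bigD1 (Ordinal nb)) //= IHb nbE [X in _ + X]big1 ?addr0 // => i inb.
have [ltib|leib] := ltnP i (n * b); first by rewrite IH0 ?mul0r.
have ltnbi : (n * b < i)%N by rewrite ltn_neqAle leib andbT eq_sym.
by rewrite [t`[_]]tb ?mulr0 //; have := ltn_ord i; lia.
Qed.

Lemma colon_ideal Q f : is_ideal Q -> is_ideal [set t | Q (t * f)].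
Proof.
move=> [Q0 QD QM]; split=> [|a b /= Qa Qb|a b /= Qb] /=; first by rewrite mul0r.
  by rewrite mulrDl; apply: QD.
by rewrite -mulrA; apply: QM.
Qed.

(* The radical of (Q : f) is homogeneous; so an element outside a prime P killing
   f modulo Q may be replaced by a homogeneous one, even though P is not known to
   be homogeneous. *)
Lemma homogeneous_radical_colon Q t f : is_ideal Q -> is_homogeneous Q ->
  radical_of [set t | Q (t * f)] t ->
  forall b, radical_of [set t | Q (t * f)] t`[b].
Proof.
move=> iQ hQ Rt b; have iR := radical_of_ideal (colon_ideal f iQ).
have [m] := ubnP b; elim: m => // m IHm in b *; rewrite ltnS => bm.
(* The components below [b] lie in the radical by induction. Without them, the component in degree
   [b] becomes the lowest one, and its powers are the lowest components of the powers of [u]. *)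
pose u := t - \sum_(i < b) t`[i].
have uE d : u`[d] = if (d < b)%N then 0 else t`[d].
  have -> : u`[d] = t`[d] - \sum_(i < b) t`[i]`[d].
    by rewrite pihomogB (raddf_sum (pihomog mdeg d)).
  case: ifP => db; last first.
    rewrite [X in _ - X]big1 ?subr0 // => i _; rewrite (pihomog_ne0 _ (pihomogP _ _ _)) //.
    by apply: contraFneq db => <-.
  rewrite [X in _ - X](bigD1 (Ordinal db)) //= pihomog_id [X in _ - (_ + X)]big1.
    by rewrite addr0 subrr.
  by move=> i id; rewrite (pihomog_ne0 _ (pihomogP _ _ _)).
have [n /= Qu] : radical_of [set t | Q (t * f)] u.
  apply: idealB => //; apply: ideal_sum => // i.
  by apply: IHm; apply: leq_trans bm.
have [|u0 ub] := @pihomog_expn_lowest u b n; first by move=> d db; rewrite uE db.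
have := lowest_component_nilpotent iQ hQ u0 Qu; rewrite ub uE ltnn -exprM => Qb.
by exists (n * msize f)%N.
Qed.

Lemma homogeneous_symbolic_power I n :
  is_ideal I -> is_homogeneous I -> is_homogeneous (symbolic_power I n).
Proof.
move=> iI hI f d /symbolic_powerP If; apply/symbolic_powerP => P AP.
have [t Pt It] := If P AP; have [Pp _] := AP; have [iP _ _] := Pp.
have hE := homogeneous_ideal_exp (n := n) iI hI.
have [b Ptb] : exists b, ~ P t`[b].
  apply: contrapT => /forallNP tP; apply: Pt; rewrite [t]pihomog_sum.
  by apply: ideal_sum => // i; apply: contrapT; apply: tP.
have [|m /= Im] := @homogeneous_radical_colon _ t f (ideal_exp_ideal I n) hE _ b.
  by exists 1; rewrite expr1.
exists (t`[b] ^+ m); first by move/(prime_expn Pp).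
have hb : t`[b] ^+ m \is (b * m).-homog by apply: dhomogMn; apply: pihomogP.
(* Multiplication by a form of degree [b * m] shifts degrees, so this component is the form times
   the component of [f] in degree [d]. *)
have := hE _ (b * m + d)%N Im.
by rewrite (pihomog_homogM _ _ hb) leq_addr addKn.
Qed.

End Grading.
(** * Generation in bounded degree *)

Section Generation.
Variables (k : nat) (K : fieldType).
Implicit Types (f g h l : {mpoly K[k]}) (I J Q : set {mpoly K[k]}) (d e n s : nat).

Local Notation "f `[ d ]" := (pihomog mdeg d f) (at level 3, format "f `[ d ]").

Lemma mnm_pos_split (m : 'X_{1..k}) : (0 < mdeg m)%N ->
  exists i m', m = (U_(i) + m')%MM.
Proof.
move=> m0; have [i mi] : exists i, (0 < m i)%N.
  apply/existsP; apply: contraLR m0; rewrite negb_exists => /forallP m0.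
  by rewrite -leqNgt leqn0 mdeg_eq0; apply/eqP/mnmP => i; rewrite mnm0E; have := m0 i; lia.
exists i, (m - U_(i))%MM; apply/mnmP => j; rewrite mnmDE mnmBE mnm1E.
by case: eqP => [<-|_]; lia.
Qed.

Lemma mnm_split (m : 'X_{1..k}) a : (a <= mdeg m)%N ->
  exists m1 m2, m = (m1 + m2)%MM /\ mdeg m1 = a.
Proof.
elim: a m => [|a IHa] m am; first by exists 0%MM, m; rewrite add0m mdeg0.
have [i [m' mE]] := mnm_pos_split (leq_ltn_trans (leq0n a) am).
have [|m1 [m2 [m'E <-]]] := IHa m'; first by move: am; rewrite mE mdegD mdeg1.
by exists (U_(i) + m1)%MM, m2; rewrite mE m'E addmA mdegD mdeg1.
Qed.

Lemma ideal_mpolyX Q (m1 m2 : 'X_{1..k}) : is_ideal Q -> Q 'X_[m1] -> Q 'X_[m1 + m2].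
Proof. by move=> iQ Qm; rewrite mpolyXD; apply: idealMl. Qed.

Lemma ideal_mnm_of_radical Q : is_ideal Q -> (forall i, radical_of Q 'X_i) ->
  exists s, forall m : 'X_{1..k}, mdeg m = s -> Q 'X_[m].
Proof.
move=> iQ /choice[N QN]; pose M := (\sum_i N i)%N.
(* Pigeonhole: [k] exponents bounded by [M] give degree at most [k * M], and [M] is at least each
   [N i]. *)
exists (k * M).+1 => m ms; have [i Mi] : exists i, (M < m i)%N.
  apply/existsP; apply: contra_eqT ms; rewrite negb_exists => /forallP mM.
  rewrite neq_ltn ltnS mdegE; apply/orP; left.
  rewrite -[X in (_ <= X * _)%N]card_ord -sum_nat_const.
  by apply: leq_sum => i _; rewrite leqNgt.
have Ni : (N i <= m i)%N.
  by apply: leq_trans (ltnW Mi); rewrite /M (bigD1 i) //= leq_addr.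
rewrite mpolyXE_id (bigD1 i) //= -(subnK Ni) exprD -mulrA mulrCA.
by apply: idealMl.
Qed.

Definition homog_part D I : set {mpoly K[k]} :=
  [set f | I f /\ exists2 d, (d <= D)%N & f \is d.-homog].

Lemma homogeneous_gen_homog_part D I : is_homogeneous (ideal_gen (homog_part D I)).
Proof.
set G := ideal_gen _; have [G0 GD GM] : is_ideal G by apply: ideal_gen_ideal.
move=> f d Gf; suff /(_ f Gf) : G `<=` [set f | forall d, G f`[d]] by exact.
apply: ideal_gen_min.
  split=> [e|a b Ga Gb e|a b Gb e] /=; first by rewrite pihomog0.
    by rewrite pihomogD; apply: GD.
  by rewrite pihomogM; apply: ideal_sum => // i; apply: GM.
move=> g Sg e /=; have [Ig [d' _ gd']] := Sg.
have [->|ed] := eqVneq e d'; last by rewrite (pihomog_ne0 _ gd') // eq_sym.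
by rewrite pihomog_dE //; apply: sub_ideal_gen.
Qed.

Lemma homog_msize f d : f \is d.-homog -> (msize f <= d.+1)%N.
Proof.
move/dhomogP => hf; rewrite msizeE; apply/bigmax_leqP_seq => m mf _.
by rewrite ltnS -(hf m mf).
Qed.

(** A monomial of degree [s] is split off at each step; modulo [l] the product of the parts in [J]
    remains. It is kept homogeneous of degree [s * n] to serve as a generator later. *)
Lemma monomials_exp J l e s : is_ideal J -> is_homogeneous J -> l \is e.-homog ->
  (forall m, mdeg m = s -> ideal_add J l 'X_[m]) ->
  forall n m, mdeg m = (s * n)%N ->
    exists j c, [/\ ideal_exp J n j, j \is (s * n).-homog & 'X_[m] = j + l * c].
Proof.
move=> iJ hJ hl Js; elim=> [|n IHn] m ms.
  have -> : m = 0%MM by apply/eqP; rewrite -mdeg_eq0 ms muln0.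
  exists 1, 0; rewrite mulr0 addr0 mpolyX0 muln0 dhomog1; split=> //.
  by have := @ideal_exp_prod _ J 0 (fun=> 0) (fun i => match notF (ltn_ord i) with end);
    rewrite big_ord0.
have [|m1 [m2 [mE m1s]]] := @mnm_split m s; first by rewrite ms mulnS leq_addr.
have [|j2 [c2 [Jj2 hj2 m2E]]] := IHn m2.
  by apply: (@addnI s); rewrite -mulnS -ms mE mdegD m1s.
have [j1 [c1 [Jj1 m1E]]] := Js m1 m1s.
(* The test guards against truncated subtraction: for [e > s], [l * c1] has no component of degree
   [s]. *)
pose c1' := if (e <= s)%N then c1`[s - e] else 0.
have m1E' : 'X_[m1] = j1`[s] + l * c1'.
  have -> : l * c1' = (l * c1)`[s].
    by rewrite (pihomog_homogM _ _ hl) /c1'; case: ifP; rewrite ?mulr0.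
  by rewrite -pihomogD -m1E pihomog_dE // dhomogX /= m1s.
exists (j2 * j1`[s]), (j2 * c1' + c2 * 'X_[m1]); split.
- by apply: ideal_exp_mulr => //; apply: hJ.
- by rewrite mulnSr; apply: dhomogM => //; apply: pihomogP.
- by rewrite mE addmC mpolyXD m2E mulrDl [in X in X + _]m1E'; ring.
Qed.

(** The alternative [l = 0] serves an ideal containing all variables, whose associated prime may
    contain every form of positive degree; the monomials of degree [s * n] then lie in J^n
    itself. *)
Lemma symbolic_power_generated J l e s n :
  is_ideal J -> is_homogeneous J -> l \is e.-homog ->
  l = 0 \/ (0 < e)%N /\ (forall P, Ass J P -> ~ P l) ->
  (forall m, mdeg m = s -> ideal_add J l 'X_[m]) ->
  generated_in_degrees_le (s * n)%N (symbolic_power J n).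
Proof.
move=> iJ hJ hl lJ Js; have iS := symbolic_power_ideal J n.
exists (homog_part (s * n) (symbolic_power J n)); split.
  by move=> f [_ [d ds /homog_msize hf]]; apply: leq_trans hf _.
set G := ideal_gen _; have iG : is_ideal G by apply: ideal_gen_ideal.
have GS : G `<=` symbolic_power J n by apply: ideal_gen_min => // f [].
have hS := homogeneous_symbolic_power (n := n) iJ hJ.
have hG : is_homogeneous G by apply: homogeneous_gen_homog_part.
suff homG d h : h \is d.-homog -> symbolic_power J n h -> G h.
  apply/seteqP; split=> // h Sh; rewrite [h]pihomog_sum; apply: ideal_sum => // d.
  by apply: (homG d); [exact: pihomogP|exact: hS].
have [b] := ubnP d; elim: b => // b IHb in d h *; rewrite ltnS => db hh Sh.
have [dD|Dd] := leqP d (s * n); first by apply: sub_ideal_gen; split=> //; exists d.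
(* Each monomial of [h] has a factor of degree [s * n], whose part in J^n is one of the generators
   of [G]. *)
have [u [c [Gu hE]]] : ideal_add G l h.
  rewrite [h]mpolyE big_seq; apply: big_ind => [||m mh].
  - by case: (ideal_add_ideal l iG).
  - by case: (ideal_add_ideal l iG).
  have [|m1 [m2 [mE m1D]]] := @mnm_split m (s * n).
    by rewrite (dhomog_mf hh mh) ltnW.
  rewrite mE mpolyXD -mul_mpolyC; have [_ _ GM] := ideal_add_ideal l iG.
  apply: (GM); apply: idealMl; first exact: ideal_add_ideal.
  have [j [c [Jj hj ->]]] := monomials_exp iJ hJ hl Js m1D.
  exists j, c; split=> //; apply: sub_ideal_gen; split; last by exists (s * n)%N.
  exact: ideal_exp_symbolic.
have hE' : h = u`[d] + (l * c)`[d] by rewrite -pihomogD -hE pihomog_dE.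
case: lJ => [l0|[e0 lP]].
  by rewrite hE' l0 mul0r pihomog0 addr0; apply: hG.
rewrite hE' (pihomog_homogM _ _ hl); case: ifP => ed; last by rewrite addr0; apply: hG.
case: (iG) => _ GD GM; apply: GD; first exact: hG.
apply: GM; apply: (IHb (d - e)%N); first by lia.
  exact: pihomogP.
apply: (symbolic_power_cancel lP).
have -> : l * c`[d - e] = h - u`[d].
  by rewrite [X in X - _]hE' addrC addKr (pihomog_homogM _ _ hl) ed.
exact: (idealB iS Sh (GS _ (hG _ _ Gu))).
Qed.

(** A prime (J : f) containing [l] contains J + (l), hence all variables. Some component f_d is
    outside [J] and all variables send it into [J]. If d = 0, this puts the variables in [J]; if d >
    0, it puts the square of f_d in the radical ideal [J]. *)
Lemma Ass_avoid J l : is_ideal J -> is_homogeneous J -> is_radical J ->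
  ~ (forall i, J 'X_i) -> (forall i, radical_of (ideal_add J l) 'X_i) ->
  forall P, Ass J P -> ~ P l.
Proof.
move=> iJ hJ rJ nJ radJ P [Pp [f PE]] Pl; apply: nJ => i.
have [J0 JD JM] := iJ; have [[P0 PD PM] P1 _] := Pp.
have JP a : J a -> P a by move=> Ja; rewrite PE /= ; apply: idealMl.
have PX j : P 'X_j.
  have [n [a [c [Ja E]]]] := radJ j; apply: (prime_expn Pp (n := n)).
  by rewrite E; apply: PD; [apply: JP|rewrite mulrC; apply: PM].
have Jf : ~ J f by move=> Jf; apply: P1; rewrite PE /= mul1r.
have [d Jfd] : exists d, ~ J f`[d].
  apply: contrapT => /forallNP fJ; apply: Jf; rewrite [f]pihomog_sum.
  by apply: ideal_sum => // j; apply: contrapT; apply: fJ.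
have Xfd j : J ('X_j * f`[d]).
  have hX : ('X_j : {mpoly K[k]}) \is 1.-homog by rewrite dhomogX /= mdeg1.
  have := PX j; rewrite PE /= => /(hJ _ d.+1).
  by rewrite (pihomog_homogM _ _ hX) subn1.
have [d0|d0] := posnP d.
  have fC : f`[d] = (f@_0%MM)%:MP.
    apply/mpolyP => m; rewrite mcoeff_pihomog mcoeffC d0 mdeg_eq0.
    by case: eqP => [->|_]; rewrite ?mulr1 ?mulr0.
  have f0 : f@_0%MM != 0 by apply/eqP => f0; apply: Jfd; rewrite fC f0.
  have := JM ((f@_0%MM)^-1)%:MP _ (Xfd i).
  by rewrite fC mulrCA -mpolyCM mulVf // mulr1.
case: Jfd; apply: (rJ _ 2); rewrite expr2 {1}[f`[d]]mpolyE mulr_suml big_seq.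
apply: big_ind => // m mf; have md : mdeg m = d by apply: dhomog_mf mf; apply: pihomogP.
have [|j [m' ->]] := @mnm_pos_split m; first by rewrite md.
by rewrite addmC mpolyXD -mul_mpolyC -!mulrA; apply: (JM); apply: (JM).
Qed.

Lemma symbolic_power_linear_bound J l e :
  is_ideal J -> is_homogeneous J -> is_radical J -> (0 < e)%N -> l \is e.-homog ->
  (forall i, radical_of (ideal_add J l) 'X_i) ->
  exists s, forall n, generated_in_degrees_le (s * n)%N (symbolic_power J n).
Proof.
move=> iJ hJ rJ e0 hl radJ.
have [JX|nJX] := pselect (forall i, J 'X_i).
  (* The irrelevant ideal may be associated to J, and l is of no use. *)
  exists 1 => n; apply: (@symbolic_power_generated J 0 0) => //; first exact: dhomog0.
    by left.
  move=> m m1; exists 'X_[m], 0; rewrite mulr0 addr0; split=> //.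
  have [|i [m' ->]] := @mnm_pos_split m; first by rewrite m1.
  exact: ideal_mpolyX.
have [s Qs] := ideal_mnm_of_radical (ideal_add_ideal l iJ) radJ.
exists s => n; apply: (@symbolic_power_generated J l e) => //.
by right; split=> //; apply: Ass_avoid.
Qed.

End Generation.
(** * A form avoiding the zeros of J *)

Definition no_common_prime (R : comNzRingType) (J : set R) :=
  forall p, prime_elt p -> exists2 g, J g & ~ multiples p g.

Section VariableElimination.
Variables (n : nat) (K : fieldType).
Implicit Types (f g : {mpoly K[n.+1]}) (J : set {mpoly K[n.+1]}) (d : nat) (e : 'I_n.+1).

Lemma mcoeff_mwiden (c : {mpoly K[n]}) (m : 'X_{1..n.+1}) :
  (0 < m ord_max)%N -> (mwiden c)@_m = 0.
Proof.
move=> m0; rewrite (mwidenE (leqnn _)) raddf_sum /=; apply: big1 => i _.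
rewrite mcoeffZ mcoeffX; case: eqP => [mE|_]; last by rewrite mulr0.
by move: m0; rewrite -mE mnmwiden_ordmax.
Qed.

Lemma elim_last J f : is_ideal J -> J f -> f != 0 -> no_common_prime J ->
  exists2 c : {mpoly K[n]}, c != 0 & J (mwiden c).
Proof.
move=> [J0 JD JM] Jf f0 npJ.
pose psi : {rmorphism _ -> _} := @mpoly_of_uni n K.
have psiK := @mpoly_of_uniK n K; have muK := @muniK n K.
have [||||c c0 Jc] := @elim_ideal _ (@factorial_mpoly K n) (psi @^-1` J) (muni f).
- split=> [|a b|a b]; rewrite /preimage /= ?rmorph0 ?rmorphD ?rmorphM //.
    exact: JD.
  exact: JM.
- by rewrite /preimage /= muK.
- by apply: contraNneq f0 => mf; rewrite -[f]muK mf rmorph0.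
- move=> q /(prime_elt_iso (psi := psi) psiK muK) /npJ[g Jg qg].
  exists (muni g); first by rewrite /preimage /= muK.
  by move/(multiples_iso (psi := psi) psiK muK); rewrite /= muK.
by exists c => //; rewrite -mpoly_of_uniC.
Qed.

Lemma elim_var J f e : is_ideal J -> J f -> f != 0 -> no_common_prime J ->
  exists g, [/\ g != 0, J g & forall m : 'X_{1..n.+1}, (0 < m e)%N -> g@_m = 0].
Proof.
move=> [J0 JD JM] Jf f0 npJ; pose s := tperm ord_max e.
pose psi : {rmorphism _ -> _} := @msym n.+1 K s.
have psiK : cancel psi psi by move=> g; rewrite /= -msymMm tperm2 msym1m.
have [||||c c0 Jc] := @elim_last (psi @^-1` J) (psi f).
- split=> [|a b|a b]; rewrite /preimage /= ?rmorph0 ?rmorphD ?rmorphM //.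
    exact: JD.
  exact: JM.
- by rewrite /preimage /= psiK.
- by apply: contraNneq f0 => mf; rewrite -[f]psiK mf rmorph0.
- move=> q /(prime_elt_iso (psi := psi) psiK psiK) /npJ[g Jg qg].
  exists (psi g); first by rewrite /preimage /= psiK.
  by move/(multiples_iso (psi := psi) psiK psiK); rewrite psiK.
exists (psi (mwiden c)); split=> //.
  apply: contraNneq c0 => /(congr1 psi); rewrite psiK rmorph0 => e0.
  by apply/eqP/inj_mwiden; rewrite e0 mwiden0.
move=> m me; rewrite /= mcoeff_sym; apply: mcoeff_mwiden.
by rewrite mnmE tpermL.
Qed.

Lemma homogeneous_elim_var J f e : is_ideal J -> is_homogeneous J ->
    J f -> f != 0 -> no_common_prime J ->
  exists d g, [/\ J g, g \is d.-homog, exists2 m : 'X_{1..n.+1}, m e = 0%N & g@_m != 0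
    & forall m : 'X_{1..n.+1}, (0 < m e)%N -> g@_m = 0].
Proof.
move=> iJ hJ Jf f0 npJ; have [g [g0 Jg ge]] := elim_var e iJ Jf f0 npJ.
(* Any degree with a nonzero component of [g] would do; that of the leading monomial is one. *)
exists (mdeg (mlead g)), (pihomog mdeg (mdeg (mlead g)) g); split.
- exact: hJ.
- exact: pihomogP.
- exists (mlead g); last by rewrite mcoeff_pihomog eqxx mleadc_eq0.
  apply/eqP; rewrite -leqn0 leqNgt; apply/negP => /ge/eqP.
  by rewrite mleadc_eq0 (negPf g0).
- by move=> m /ge gm; rewrite mcoeff_pihomog gm if_same.
Qed.

Lemma multiples_var e f :
  (forall m : 'X_{1..n.+1}, m e = 0%N -> f@_m = 0) -> multiples 'X_e f.
Proof.
have [M0 MD MM] := @multiples_ideal _ ('X_e : {mpoly K[n.+1]}).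
move=> fe; rewrite [f]mpolyE big_seq.
apply: big_ind => // m mf; rewrite -mul_mpolyC; apply: MM.
exists 'X_[m - U_(e)]; rewrite -mpolyXD submK // lep1mP.
by apply: contraL mf => /eqP/fe fm; rewrite mcoeff_msupp fm eqxx.
Qed.

(** The multiples of ['X_e] are the kernel of the substitution of 0 for ['X_e], a morphism into a
    domain. *)
Lemma prime_var e : prime_elt ('X_e : {mpoly K[n.+1]}).
Proof.
pose phi : {rmorphism {mpoly K[n.+1]} -> {mpoly K[n.+1]}} :=
  mmap (@mpolyC n.+1 K) (fun i => if i == e then 0 else 'X_i).
have phiX : phi 'X_e = 0 by rewrite /= mmapX mmap1U eqxx.
have phiP f : multiples 'X_e f <-> phi f = 0.
  split=> [[c ->]|f0]; first by rewrite rmorphM phiX mulr0.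
  have [M0 MD MM] := @multiples_ideal _ ('X_e : {mpoly K[n.+1]}).
  rewrite -[f]subr0 -f0 [f in phi f]mpolyE {1}[f]mpolyE rmorph_sum -sumrB.
  apply: ideal_sum => [|m]; first exact: multiples_ideal.
  rewrite -mul_mpolyC rmorphM /= mmapC -mulrBr; apply: MM; rewrite mmapX.
  have [me|me] := posnP (m e).
    suff -> : mmap1 (fun i => if i == e then 0 else 'X_i) m = 'X_[m] :> {mpoly K[n.+1]}.
      by rewrite subrr.
    rewrite mpolyXE_id; apply: eq_bigr => i _; case: eqP => // ->.
    by rewrite me.
  have -> : mmap1 (fun i => if i == e then 0 else 'X_i) m = 0 :> {mpoly K[n.+1]}.
    by rewrite /mmap1 (bigD1 e) //= eqxx expr0n (gtn_eqF me) mul0r.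
  rewrite subr0 [X in multiples _ X]mpolyXE_id (bigD1 e) //=; apply: multiplesMl.
  by rewrite -(prednK me) exprS; apply: multiplesMl; exact: multiples_id.
split.
  apply/eqP => /mpolyP/(_ U_(e)%MM)/eqP.
  by rewrite mcoeffXU mcoeff0 eqxx oner_eq0.
split; first exact: multiples_ideal.
  by rewrite phiP rmorph1 => /eqP; rewrite oner_eq0.
move=> a b; rewrite !phiP rmorphM => /eqP; rewrite mulf_eq0.
by case/orP => /eqP; [left|right].
Qed.

End VariableElimination.

(** * Binary forms as restrictions to a coordinate line *)

Section BinaryForms.
Variables (K : fieldType) (e a b : 'I_3).
Hypotheses (ab : a != b) (ea : e != a) (eb : e != b).
Implicit Types (f : {mpoly K[3]}) (d : nat).

Lemma homog_var (i : 'I_3) d : ('X_i ^+ d : {mpoly K[3]}) \is d.-homog.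
Proof.
have h : ('X_i : {mpoly K[3]}) \is 1.-homog by rewrite dhomogX /= mdeg1.
by have := dhomogMn d h; rewrite mul1n.
Qed.

(** Here [t] is the index of the first nonzero [r j]; the cofactor [G] then contains the pure power
    of ['X_b], so it is nonzero modulo ['X_a]. *)
Lemma binary_form_normal d (r : nat -> K) i : (i <= d)%N -> r i != 0 ->
  exists t k G, [/\ G \is k.-homog,
    \sum_(j < d.+1) r j *: ('X_a ^+ j * 'X_b ^+ (d - j)) = 'X_a ^+ t * G
    & exists c q, c != 0 /\ G = c *: 'X_b ^+ k + 'X_a * q].
Proof.
elim: d r i => [|d IHd] r i id ri; have [r0|r0] := eqVneq (r 0%N) 0.
- by move: ri; rewrite leqn0 in id; rewrite (eqP id) r0 eqxx.
- exists 0%N, 0%N, (r 0%N *: 1); split.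
  + by rewrite dhomogZ // dhomog1.
  + by rewrite big_ord1 !expr0 !mul1r.
  + by exists (r 0%N), 0; rewrite mulr0 addr0.
- case: i id ri => [|i] id ri; first by rewrite r0 eqxx in ri.
  have [t [k [G [hG E nG]]]] := IHd (fun j => r j.+1) i id ri.
  exists t.+1, k, G; split=> //; rewrite big_ord_recl r0 scale0r add0r.
  rewrite exprS -mulrA -E mulr_sumr; apply: eq_bigr => j _.
  by rewrite /= /bump /= add1n subSS exprS -scalerAr mulrA.
- exists 0%N, d.+1, (\sum_(j < d.+2) r j *: ('X_a ^+ j * 'X_b ^+ (d.+1 - j))); split.
  + apply: rpred_sum => j _; apply: dhomogZ.
    have := dhomogM (homog_var a j) (homog_var b (d.+1 - j)).
    by rewrite subnKC // -ltnS ltn_ord.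
  + by rewrite mul1r.
  + exists (r 0%N), (\sum_(j < d.+1) r j.+1 *: ('X_a ^+ j * 'X_b ^+ (d - j))); split=> //.
    rewrite big_ord_recl expr0 mul1r subn0; congr (_ + _).
    rewrite mulr_sumr; apply: eq_bigr => j _.
    by rewrite /= /bump /= add1n subSS exprS -scalerAr mulrA.
Qed.

Let mon d j : 'X_{1..3} := (U_(a) *+ j + U_(b) *+ (d - j))%MM.

(** The sum is the restriction of [f] to the line ['X_e = 0]: among three variables, a monomial of
    degree [d] free of ['X_e] is determined by its exponent in ['X_a]. *)
Lemma mcoeff_binary_part f d m : f \is d.-homog ->
  (\sum_(j < d.+1) f@_(mon d j) *: ('X_a ^+ j * 'X_b ^+ (d - j)))@_m =
  if m e == 0%N then f@_m else 0.
Proof.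
move=> hf.
have monE j : 'X_a ^+ j * 'X_b ^+ (d - j) = 'X_[mon d j] :> {mpoly K[3]}.
  by rewrite mpolyXD !mpolyXn.
have mon_e j : mon d j e = 0%N.
  rewrite mnmDE !mulmnE !mnm1E [a == e]eq_sym [b == e]eq_sym.
  by rewrite (negPf ea) (negPf eb) !mul0n.
have mon_a j : mon d j a = j.
  by rewrite mnmDE !mulmnE !mnm1E eqxx [b == a]eq_sym (negPf ab) mul1n mul0n addn0.
have mdeg_mon j : (j <= d)%N -> mdeg (mon d j) = d.
  by move=> jd; rewrite mdegD !mdegMn !mdeg1 !mul1n subnKC.
rewrite raddf_sum /=; under eq_bigr do rewrite monE mcoeffZ mcoeffX.
have [me|me] := eqVneq (m e) 0%N; last first.
  apply: big1 => j _; case: eqP => [mE|_]; last by rewrite mulr0.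
  by move: me; rewrite -mE mon_e.
have [md|md] := eqVneq (mdeg m) d; last first.
  rewrite (dhomog_nemf_coeff hf md); apply: big1 => j _.
  case: eqP => [mE|_]; last by rewrite mulr0.
  by move: md; rewrite -mE mdeg_mon ?eqxx // -ltnS.
have iE i : [\/ i = e, i = a | i = b].
  have := eb; have := ea; have := ab; rewrite -!val_eqE /=.
  have := ltn_ord i; have := ltn_ord e; have := ltn_ord a; have := ltn_ord b.
  by move=> *; have [->|ie] := eqVneq i e; [by constructor 1|];
    have [->|ia] := eqVneq i a; [by constructor 2|constructor 3];
    apply: val_inj; move: ie ia; rewrite -!val_eqE /=; lia.
have dE : d = (m a + m b)%N.
  rewrite -md mdegE (bigD1 e) //= me (bigD1 a) 1?eq_sym //= (bigD1 b) /=; last first.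
    by rewrite [b == e]eq_sym eb [b == a]eq_sym.
  by rewrite big1 ?addn0 // => i; case: (iE i) => ->; rewrite !eqxx ?andbF.
have mE : m = mon d (m a).
  apply/mnmP => i; case: (iE i) => ->; rewrite ?mon_e ?mon_a //.
  rewrite mnmDE !mulmnE !mnm1E eqxx (negPf ab) mul0n mul1n add0n.
  by rewrite dE addKn.
have ma : (m a < d.+1)%N by rewrite ltnS dE leq_addr.
rewrite [LHS](bigD1 (Ordinal ma)) //= [X in _ + X]big1 => [|j ja].
  by rewrite -mE eqxx mulr1 addr0.
case: eqP => [jE|_]; last by rewrite mulr0.
by case/eqP: ja; apply: val_inj; rewrite /= -(mon_a j) jE.
Qed.

End BinaryForms.
Lemma homog_normal (K : fieldType) (e a b : 'I_3) (f : {mpoly K[3]}) d :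
    a != b -> e != a -> e != b -> f \is d.-homog ->
    (exists2 m : 'X_{1..3}, m e = 0%N & f@_m != 0) ->
  exists t k G q, [/\ G \is k.-homog, f = 'X_a ^+ t * G + 'X_e * q,
    (exists c h, c != 0 /\ G = c *: 'X_b ^+ k + 'X_a * h) &
    (forall m : 'X_{1..3}, (0 < m e)%N -> f@_m = 0) -> f = 'X_a ^+ t * G].
Proof.
move=> ab ea eb hf [m me fm]; have cP := mcoeff_binary_part ab ea eb _ hf.
have [i id fi] : exists2 i, (i <= d)%N & f@_(U_(a) *+ i + U_(b) *+ (d - i)) != 0.
  apply: contrapT => nf; move/eqP: fm; apply; have := cP m; rewrite me eqxx => <-.
  rewrite big1 ?mcoeff0 // => j _; apply/eqP; rewrite scaler_eq0.
  by apply/orP; left; apply: contra_notT nf => fj; exists (val j); rewrite ?leq_ord.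
have [t [k [G [hG E nG]]]] := binary_form_normal a b
  (r := fun j => f@_(U_(a) *+ j + U_(b) *+ (d - j))) id fi.
rewrite E in cP; have [|q qE] := @multiples_var 2 K e (f - 'X_a ^+ t * G).
  by move=> m' m'e; rewrite mcoeffB cP m'e eqxx subrr.
exists t, k, G, q; split=> //; first by rewrite ['X_e * q]mulrC -qE addrC subrK.
move=> fe; apply/mpolyP => m'; rewrite cP; case: posnP => // m'e.
by rewrite fe // gtn_eqF.
Qed.

Section RadicalIdeal.
Variables (R : comNzRingType) (Q : set R).
Hypotheses (iQ : is_ideal Q) (rQ : is_radical Q).

Lemma radical_mul_expl n f g : Q (f ^+ n * g) -> Q (f * g).
Proof.
case: n => [|n] Qfg; first by case: iQ => _ _ QM; apply: QM; rewrite mul1r in Qfg.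
apply: (rQ (n := n.+1)); rewrite exprMn [g ^+ _]exprS mulrA.
exact: idealMl.
Qed.

Lemma radical_mul_expr n f g : Q (f * g ^+ n) -> Q (f * g).
Proof. by rewrite mulrC => /radical_mul_expl; rewrite mulrC. Qed.

(** [Q] will be the radical of J + (l), with l = x^(n+1) + w, and [cx], [cy], [cz] nonzero
    constants. As x w is in [Q], so is x. Then y Gx is in [Q] and kills the first summand of w, so y
    w gives y V, which is a constant times a power of y modulo x. Finally, modulo x and y, U Gx is a
    constant times a power of z. *)
Lemma radical_contains_vars (x y z Gx Gy Gz cx cy cz hx hy hz : R) (kx ky kz n : nat) :
    (forall h, Q (cx * h) -> Q h) -> (forall h, Q (cy * h) -> Q h) ->
    (forall h, Q (cz * h) -> Q h) ->
    Gx = cx * z ^+ kx + y * hx -> Gy = cy * z ^+ ky + x * hy ->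
    Gz = cz * y ^+ kz + x * hz ->
    Q (x * (y * Gz)) -> Q (x * (z * Gy)) -> (Q x -> Q (y * Gx)) ->
    Q (x ^+ n.+1 + ((z * Gy) ^+ kz.+1 * Gx ^+ kz.+1 + (y * Gz) ^+ (ky + kx).+1)) ->
  [/\ Q x, Q y & Q z].
Proof.
set U := z * Gy; set V := y * Gz; set w := _ + V ^+ _.
move=> Qcx Qcy Qcz GxE GyE GzE QxV QxU QyG Ql; have [Q0 QD QM] := iQ.
have Qxw : Q (x * w).
  have -> : x * w = (x * U) * (U ^+ kz * Gx ^+ kz.+1) + (x * V) * V ^+ (ky + kx).
    by rewrite /w !exprS; ring.
  by apply: QD; apply: idealMl.
have Qx : Q x.
  apply: (rQ (n := n.+2)); rewrite exprS.
  have -> : x * x ^+ n.+1 = x * (x ^+ n.+1 + w) - x * w by ring.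
  by apply: idealB => //; apply: QM.
have {Ql} Qw : Q w by apply: idealDr Ql => //; rewrite exprS; apply: idealMl.
have {}QyG := QyG Qx.
have Qy : Q y.
  have QyV : Q (y * V).
    apply: (radical_mul_expr (n := (ky + kx).+1)).
    have -> : y * V ^+ (ky + kx).+1 = y * w - y * Gx * (U ^+ kz.+1 * Gx ^+ kz).
      by rewrite /w !exprS; ring.
    by apply: idealB => //; [apply: QM|apply: idealMl].
  apply: (rQ (n := kz.+2)); apply: Qcz.
  have -> : cz * y ^+ kz.+2 = y * V - x * (hz * y ^+ 2) by rewrite /V GzE !exprS; ring.
  by apply: idealB => //; apply: idealMl.
split=> //; have QUG : Q (U * Gx).
  apply: (rQ (n := kz.+1)); rewrite exprMn.
  have -> : U ^+ kz.+1 * Gx ^+ kz.+1 = w - y * (Gz * V ^+ (ky + kx)).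
    by rewrite /w /V !exprS; ring.
  by apply: idealB => //; apply: idealMl.
apply: (rQ (n := (ky + kx).+1)); apply: Qcx; apply: Qcy.
have -> : cy * (cx * z ^+ (ky + kx).+1) =
    U * Gx - (x * (z * hy * Gx) + y * (cy * z ^+ ky.+1 * hx)).
  by rewrite /U GxE GyE !exprS exprD; ring.
by apply: idealB => //; apply: QD; apply: idealMl.
Qed.

End RadicalIdeal.

Section AvoidingForm.
Variables (K : fieldType) (J : set {mpoly K[3]}).
Hypotheses (iJ : is_ideal J) (hJ : is_homogeneous J) (npJ : no_common_prime J).

(* The form is l = x ^ d + w, where w vanishes at the points of V(J) outside the
   line x = 0, but at none of the points on it.  Eliminating z, then y, gives
   x ^ tz * Gz and x ^ ty * Gy in J, where on x = 0 the forms Gz and Gy are powers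
   of y and z; an element of J not divisible by x restricts there to y ^ tx * Gx,
   with Gx a power of z where y = 0.  So w = (z Gy Gx) ^ A + (y Gz) ^ B works; the
   extra factors y and z only make the exponents positive. *)
Lemma exists_avoiding_form f : J f -> f != 0 ->
  exists l e, [/\ (0 < e)%N, l \is e.-homog
    & forall i, radical_of (ideal_add J l) 'X_i].
Proof.
move=> Jf f0; have [J0 JD JM] := iJ.
pose ix : 'I_3 := ord0; pose iy : 'I_3 := lift ord0 ord0; pose iz : 'I_3 := ord_max.
pose x : {mpoly K[3]} := 'X_ix; pose y : {mpoly K[3]} := 'X_iy.
pose z : {mpoly K[3]} := 'X_iz.
have [dz [fz [Jfz hfz nfz sfz]]] := homogeneous_elim_var iz iJ hJ Jf f0 npJ.
have [dy [fy [Jfy hfy nfy sfy]]] := homogeneous_elim_var iy iJ hJ Jf f0 npJ.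
have [tz [kz [Gz [_ [hGz _ [cz [hz [cz0 GzE]]] /(_ sfz) fzE]]]]] :=
  @homog_normal K iz ix iy fz dz isT isT isT hfz nfz.
have [ty [ky [Gy [_ [hGy _ [cy [hy [cy0 GyE]]] /(_ sfy) fyE]]]]] :=
  @homog_normal K iy ix iz fy dy isT isT isT hfy nfy.
have [g Jg xg] := npJ (prime_var K ix).
have [m mx gm] : exists2 m : 'X_{1..3}, m ix = 0%N & g@_m != 0.
  apply: contrapT => ng; apply: xg; apply: multiples_var => m mx.
  by apply/eqP; apply: contrapT => /negP gm; apply: ng; exists m.
pose d := mdeg m; pose fx := pihomog mdeg d g.
have Jfx : J fx by apply: hJ.
have [|tx [kx [Gx [qx [hGx fxE [cx [hx [cx0 GxE]]] _]]]]] :=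
  @homog_normal K ix iy iz fx d isT isT isT (pihomogP _ _ _).
  by exists m => //; rewrite mcoeff_pihomog eqxx.
have hX i : ('X_i : {mpoly K[3]}) \is 1.-homog by rewrite dhomogX /= mdeg1.
(* These are the degrees of [y * Gz] and of [z * Gy * Gx], so both summands of [w] have degree
   [A * B]. *)
pose A := kz.+1; pose B := (ky + kx).+1.
pose w := (z * Gy) ^+ A * Gx ^+ A + (y * Gz) ^+ B.
have hw : w \is (A * B).-homog.
  have h1 : (z * Gy) ^+ A * Gx ^+ A \is (A * B).-homog.
    have := dhomogM (dhomogMn A (dhomogM (hX iz) hGy)) (dhomogMn A hGx).
    by rewrite -mulnDl mulnC.
  have h2 : (y * Gz) ^+ B \is (A * B).-homog := dhomogMn B (dhomogM (hX iy) hGz).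
  exact: rpredD.
exists (x ^+ (A * B) + w), (A * B)%N; split; first by rewrite muln_gt0.
  by apply: rpredD => //; have := dhomogMn (A * B) (hX ix); rewrite mul1n.
set l := _ + w; set Q := radical_of _.
have iL : is_ideal (ideal_add J l) := ideal_add_ideal l iJ.
have iQ : is_ideal Q := radical_of_ideal iL.
have rQ : is_radical Q := @radical_of_radical _ _.
have [Q0 QD QM] := iQ.
have JQ h : J h -> Q h.
  by move=> Jh; apply: sub_radical_of; exists h, 0; rewrite mulr0 addr0.
have Ql : Q l by apply: sub_radical_of; exists 0, 1; rewrite mulr1 add0r.
have QZ c h : c != 0 -> Q (c *: h) -> Q h.
  move=> c0 Qch; rewrite -[h](scalerK c0) // -mul_mpolyC; exact: QM.
have Qxz : Q (x * (y * Gz)).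
  rewrite mulrCA; apply: (QM); apply: (radical_mul_expl iQ rQ (n := tz)).
  by apply: JQ; rewrite -fzE.
have Qxy : Q (x * (z * Gy)).
  rewrite mulrCA; apply: (QM); apply: (radical_mul_expl iQ rQ (n := ty)).
  by apply: JQ; rewrite -fyE.
(* The last argument is [A * B] minus one, written so that its successor is convertible to
   [A * B]. *)
have [||||||||||Qx Qy Qz] := @radical_contains_vars _ Q iQ rQ x y z Gx Gy Gz
  cx%:MP cy%:MP cz%:MP hx hy hz kx ky kz (ky + kx + kz * B).
- by move=> h; rewrite mul_mpolyC; apply: QZ.
- by move=> h; rewrite mul_mpolyC; apply: QZ.
- by move=> h; rewrite mul_mpolyC; apply: QZ.
- by rewrite mul_mpolyC.
- by rewrite mul_mpolyC.
- by rewrite mul_mpolyC.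
- exact: Qxz.
- exact: Qxy.
- move=> Qx; apply: (radical_mul_expl iQ rQ (n := tx)).
  apply: (idealDr iQ (idealMl qx iQ Qx)); rewrite addrC -fxE; exact: JQ.
- exact: Ql.
move=> i; suff [->|->|->] : [\/ i = ix, i = iy | i = iz] by [].
case: i => -[|[|[|i]]] ilt; last by [].
- by constructor 1; apply: val_inj.
- by constructor 2; apply: val_inj.
- by constructor 3; apply: val_inj.
Qed.

End AvoidingForm.
(** * Common prime factors *)

Lemma ideal_gen_scaled (R : idomainType) (q : R) (S : set R) :
  ideal_gen (scaled q S) = scaled q (ideal_gen S).
Proof.
apply/seteqP; split.
  apply: ideal_gen_min; first by apply: scaled_ideal; apply: ideal_gen_ideal.
  by move=> f [g Sg ->]; exists g => //; apply: sub_ideal_gen.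
move=> f [h Sh ->]; move: h Sh.
apply: (@ideal_gen_min _ S [set h | ideal_gen (scaled q S) (q * h)]).
  have [E0 ED EM] := ideal_gen_ideal (scaled q S).
  split=> [|a b /= Ja Jb|a b /= Ja] /=; first by rewrite mulr0.
    by rewrite mulrDr; apply: ED.
  by rewrite mulrCA; apply: EM.
by move=> g Sg; apply: sub_ideal_gen; exists g.
Qed.

Lemma msizeM_leq (K : fieldType) k (p q : {mpoly K[k]}) a b :
  (msize p <= a.+1)%N -> (msize q <= b.+1)%N -> (msize (p * q) <= (a + b).+1)%N.
Proof.
have [->|p0] := eqVneq p 0; first by rewrite mul0r msize0.
have [->|q0] := eqVneq q 0; first by rewrite mulr0 msize0.
rewrite msizeM // => pa qb; rewrite -subn1 leq_subLR add1n -addnS -addSn.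
exact: leq_add.
Qed.

Lemma generated_in_degrees_scaled (K : fieldType) k (q : {mpoly K[k]}) a d T :
  (msize q <= a.+1)%N -> generated_in_degrees_le d T ->
  generated_in_degrees_le (a + d) (scaled q T).
Proof.
move=> qa [S [Sd ->]]; exists (scaled q S); split; last by rewrite ideal_gen_scaled.
by move=> f [g /Sd gd ->]; apply: msizeM_leq.
Qed.

Lemma msize_expn (K : fieldType) k (p : {mpoly K[k]}) a n :
  (msize p <= a.+1)%N -> (msize (p ^+ n) <= (a * n).+1)%N.
Proof.
move=> pa; elim: n => [|n IHn]; first by rewrite expr0 msize1.
by rewrite exprS mulnS; apply: msizeM_leq.
Qed.

Definition linearly_generated_symbolic_powers (K : fieldType) k
    (I : set {mpoly K[k]}) :=
  exists D : nat, forall n : nat, (0 < n)%N ->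
    generated_in_degrees_le (D * n)%N (symbolic_power I n).

Section CommonPrimeFactor.
Variables (k : nat) (K : fieldType) (I : set {mpoly K[k]}) (p : {mpoly K[k]}).
Hypotheses (iI : is_ideal I) (hI : is_homogeneous I) (rI : is_radical I).
Hypotheses (pp : prime_elt p) (Ip : I `<=` multiples p).

Let J : set {mpoly K[k]} := [set j | I (p * j)].

Lemma common_factor_ideal : is_ideal J.
Proof.
have [I0 ID IM] := iI; split=> [|a b|a b] /=; first by rewrite /J /= mulr0.
  by rewrite /J /= mulrDr; apply: ID.
by rewrite /J /= mulrCA; apply: IM.
Qed.

Lemma common_factor_scaled : I = scaled p J.
Proof.
apply/seteqP; split=> [f If|f [j Jj ->]] //.
by have [c fE] := Ip If; exists c; rewrite /J /= mulrC -?fE.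
Qed.

Lemma common_factor_radical : is_radical J.
Proof.
move=> f [|n]; rewrite /J /= => Jf.
  by rewrite expr0 mulr1 in Jf; apply: idealMl.
apply: (rI (n := n.+1)); rewrite exprMn exprSr -mulrA.
by case: iI => _ _; apply.
Qed.

(** As a divisor of a nonzero form of [I], [p] is itself a form, and multiplication by it only
    shifts degrees. *)
Lemma common_factor_homogeneous f : I f -> f != 0 -> is_homogeneous J.
Proof.
move=> If f0; have [d fd0] : exists d, pihomog mdeg d f != 0.
  apply: contrapT => /forallNP fd; case/eqP: f0; rewrite [f]pihomog_sum.
  by apply: big1 => i _; apply/eqP; apply: contrapT => /negP; apply: fd.
have [q fE] := Ip (hI d If).
have [|e hp] := @homogeneous_factor _ _ p q _ d (pihomogP _ _ _) fd0.
  by rewrite mulrC.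
move=> g c; rewrite /J /= => /(hI (e + c)).
by rewrite (pihomog_homogM _ _ hp) leq_addr addKn.
Qed.

(** This supplies the hypothesis on J in [symbolic_power_scaled]. It rests on radicality: for I =
    (p^2) one has J = (p). *)
Lemma common_factor_simple f s : I f -> factors_into f s ->
  exists2 j, J j & ~ multiples p j.
Proof.
move=> If fs; apply: contrapT => nJ.
have Jp j : J j -> multiples p j.
  by move=> Jj; apply: contrapT => pj; apply: nJ; exists j.
(* Here [I] contains c p^2, hence (p c)^2, hence p c. *)
have JJ j c : J j -> j = c * p -> J c.
  move=> Jj jE; apply: (rI (n := 2)); rewrite expr2 mulrA.
  by have := idealMl c iI Jj; rewrite jE; congr I; ring.
(* Hence J = pJ, and p could be divided out forever. *)
suff noJ t g : J g -> ~ factors_into g t.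
  have [c fE] := Ip If; have [t _ ct] := factors_div pp fE fs.
  by apply: (noJ t c) => //; rewrite /J /= mulrC -fE.
have [m] := ubnP (size t); elim: m => // m IHm in t g *; rewrite ltnS => tm Jg gt.
have [c gE] := Jp g Jg; have [t' tt' ct'] := factors_div pp gE gt.
by apply: (IHm t' c) => //; [rewrite -tt'|apply: JJ gE].
Qed.

End CommonPrimeFactor.

(** * Induction on the number of prime factors *)

Lemma symbolic_powers_zero (K : fieldType) k (I : set {mpoly K[k]}) :
  is_ideal I -> (forall f, I f -> f = 0) -> linearly_generated_symbolic_powers I.
Proof.
move=> iI I0; exists 0%N => n n0; exists set0; split=> //.
have [I00 _ _] := iI; have [S0 _ _] := symbolic_power_ideal I n.
apply/seteqP; split; last first.
  by apply: ideal_gen_min => //; exact: symbolic_power_ideal.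
move=> h /symbolic_powerP Ih; suff -> : h = 0.
  by case: (ideal_gen_ideal (@set0 {mpoly K[k]})).
(* The zero ideal is its own associated prime, as the annihilator of 1, and I^n = 0 because n >
   0. *)
have [|t It nt] := Ih I.
  split; last by exists 1; apply/seteqP; split=> a /=; rewrite mulr1.
  split=> //; first by move/I0/eqP; rewrite oner_eq0.
  by move=> a b /I0/eqP; rewrite mulf_eq0 => /orP[]/eqP->; [left|right].
have : I (t * h).
  apply: (@ideal_exp_min _ I _ n iI _ _ nt) => g Ig.
  by rewrite -(prednK n0) in g Ig *; rewrite big_ord_recl; apply: idealMl.
move/I0/eqP; rewrite mulf_eq0 => /orP[]/eqP // t0.
by case: It; rewrite t0.
Qed.

Lemma symbolic_powers_no_common_prime (K : fieldType) (J : set {mpoly K[3]}) f :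
  is_ideal J -> is_homogeneous J -> is_radical J -> J f -> f != 0 ->
  no_common_prime J -> linearly_generated_symbolic_powers J.
Proof.
move=> iJ hJ rJ Jf f0 npJ.
have [l [e [e0 hl Jl]]] := exists_avoiding_form iJ hJ npJ Jf f0.
by have [s Js] := symbolic_power_linear_bound iJ hJ rJ e0 hl Jl; exists s.
Qed.

(** A common prime factor of [I] divides [f], so passing to J also replaces [f] by an element with
    one prime factor less. *)
Lemma symbolic_powers_nonzero (K : fieldType) (I : set {mpoly K[3]}) f s :
  is_ideal I -> is_homogeneous I -> is_radical I -> I f -> f != 0 ->
  factors_into f s -> linearly_generated_symbolic_powers I.
Proof.
have [m] := ubnP (size s); elim: m => // m IHm in I f s *; rewrite ltnS => sm.
move=> iI hI rI If f0 fs.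
have [npI|] := pselect (no_common_prime I).
  exact: symbolic_powers_no_common_prime If f0 npI.
move=> /existsNP[p /not_implyP[pp nI]].
have Ip : I `<=` multiples p.
  by move=> g Ig; apply: contrapT => pg; apply: nI; exists g.
have [g gE] := Ip f If; have [t st gt] := factors_div pp gE fs.
have g0 : g != 0 by apply: contraNneq f0 => g0; rewrite gE g0 mul0r.
have iJ := common_factor_ideal p iI.
have hJ := common_factor_homogeneous hI Ip If f0.
have rJ := common_factor_radical (p := p) iI rI.
have [||D JD] := IHm _ g t _ iJ hJ rJ _ g0 gt.
- by rewrite -st.
- by rewrite /= mulrC -gE.
(* The generators of J^(n) are multiplied by [p ^+ n], of degree at most [msize p * n]. *)
exists (msize p + D)%N => n n0.
rewrite (common_factor_scaled Ip) symbolic_power_scaled //; last first.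
  exact: common_factor_simple If fs.
rewrite mulnDl; apply: generated_in_degrees_scaled; last exact: JD.
exact: msize_expn.
Qed.

Theorem corollary1p2 (K : fieldType) (I : set {mpoly K[3]})
  (idealI : is_ideal I) (homI : is_homogeneous I) (radI : is_radical I) :
  exists D : nat, forall n : nat, (0 < n)%N ->
    generated_in_degrees_le (D * n)%N (symbolic_power I n).
Proof.
have [I0|] := pselect (forall f, I f -> f = 0).
  exact: symbolic_powers_zero.
move=> /existsNP[f /not_implyP[If /eqP f0]].
have [s fs] := factorial_mpoly f0.
exact: symbolic_powers_nonzero If f0 fs.
Qed.
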